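(* Let $\oplus$-SETH denote the statement: for every $\epsilon<1$ there is an integer $k$ such that $k$-$\oplus$CNF-SAT cannot be computed in time $O(2^{\epsilon n})$. Each of the following statements is equivalent to $\oplus$-SETH: (i) for every $\epsilon<1$ there is $k$ such that $k$-$\oplus$CNF-SAT cannot be computed in time $O(2^{\epsilon n})$; (ii) for every $\epsilon<1$ there is $k$ such that $k$-$\oplus$Hitting Set cannot be computed in time $O(2^{\epsilon n})$; (iii) for every $\epsilon<1$ there is $k$ such that $k$-$\oplus$Set Cover cannot be computed in time $O(2^{\epsilon n})$.
   Context: ''Computed in time $T$'' refers to bounded-error randomized algorithms (error probability at most $1/3$). $k$-$\oplus$CNF-SAT: given an $n$-variable CNF formula with clauses of size at most $k$, decide whether its number of satisfying assignments is odd. $k$-$\oplus$Hitting Set: given a family $\mathcal F\subseteq 2^U$, $|U|=n$, all sets of size at most $k$, decide whether the number of $H\subseteq U$ with $H\cap S\ne\emptyset$ for all $S\in\mathcal F$ is odd. $k$-$\oplus$Set Cover: given such a family over a universe $U$ of size $n$, decide whether the number of subfamilies $\mathcal C\subseteq\mathcal F$ with $\bigcup_{S\in\mathcal C}S=U$ is odd. *)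

(* Defs.v *)
From HB Require Import structures.
From mathcomp Require Import all_boot all_order all_algebra.
From mathcomp Require Import all_classical all_reals all_analysis.

Set Implicit Arguments.
Unset Strict Implicit.
Unset Printing Implicit Defensive.

Import Order.TTheory GRing.Theory Num.Theory.
Import numFieldNormedType.Exports.

Local Open Scope nat_scope.

(** * Randomized random-access machines

    The model of computation is the random-access machine with coin tosses
    under the logarithmic cost criterion, programmed in structured form.
    A program is a fixed finite term, so it mentions finitely many registers;
    the memory is addressed by arbitrary natural numbers.  Subtraction is
    truncated, and a number counts as true when it is nonzero. *)

Inductive binop := Add | Sub | Mul | Div.

Definition binop_sem (o : binop) : nat -> nat -> nat :=
  match o with
  | Add => addn
  | Sub => subn
  | Mul => muln
  | Div => divn
  end.

Inductive expr :=
| Cst of nat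
| Reg of nat
| Mem of expr
| Bin of binop & expr & expr.

Inductive prog :=
| Skip
| Assign of nat & expr
| Store of expr & expr
| Toss of nat
| Seq of prog & prog
| If of expr & prog & prog
| While of expr & prog.

Record state := State { regs : nat -> nat; memory : nat -> nat }.

Definition set_reg (s : state) (x v : nat) : state :=
  State [eta regs s with x |-> v] (memory s).

Definition set_mem (s : state) (a v : nat) : state :=
  State (regs s) [eta memory s with a |-> v].

Fixpoint eval (s : state) (e : expr) : nat :=
  match e with
  | Cst c => c
  | Reg x => regs s x
  | Mem a => memory s (eval s a)
  | Bin o e1 e2 => binop_sem o (eval s e1) (eval s e2)
  end.

(** Binary length, with [bitlen 0 = 1]. *)
Definition bitlen (v : nat) : nat := (trunc_log 2 v).+1.

(** Every value that occurs during an evaluation, addresses included, is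
    charged its binary length. *)
Fixpoint cost (s : state) (e : expr) : nat :=
  bitlen (eval s e) +
  match e with
  | Cst _ | Reg _ => 0
  | Mem a => cost s a
  | Bin _ e1 e2 => cost s e1 + cost s e2
  end.

(** [exec p s r s' r' t]: started in state [s] with the sequence [r] of random
    bits still available, [p] halts in state [s'] after time [t], leaving the
    bits [r'] unused.  A coin toss is stuck when no bit is available. *)
Inductive exec :
  prog -> state -> seq bool -> state -> seq bool -> nat -> Prop :=
| exec_skip s r : exec Skip s r s r 1
| exec_assign x e s r :
    exec (Assign x e) s r (set_reg s x (eval s e)) r (cost s e)
| exec_store a e s r :
    exec (Store a e) s r (set_mem s (eval s a) (eval s e)) r
         (cost s a + cost s e)
| exec_toss x s (b : bool) r :
    exec (Toss x) s (b :: r) (set_reg s x b) r 1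
| exec_seq p1 p2 s0 r0 s1 r1 t1 s2 r2 t2 :
    exec p1 s0 r0 s1 r1 t1 -> exec p2 s1 r1 s2 r2 t2 ->
    exec (Seq p1 p2) s0 r0 s2 r2 (t1 + t2)
| exec_if e p1 p2 s r s' r' t :
    exec (if eval s e != 0 then p1 else p2) s r s' r' t ->
    exec (If e p1 p2) s r s' r' (cost s e + t)
| exec_while_stop e p s r :
    eval s e = 0 -> exec (While e p) s r s r (cost s e)
| exec_while_step e p s0 r0 s1 r1 t1 s2 r2 t2 :
    eval s0 e != 0 ->
    exec p s0 r0 s1 r1 t1 -> exec (While e p) s1 r1 s2 r2 t2 ->
    exec (While e p) s0 r0 s2 r2 (cost s0 e + t1 + t2).

(** The input word occupies the first cells of the memory; everything else is
    zero. *)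
Definition init_state (w : seq nat) : state := State (fun=> 0) (nth 0 w).

Definition halts_within (p : prog) (w : seq nat) (r : seq bool) (t : nat) :
    Prop :=
  exists s' r' t', exec p (init_state w) r s' r' t' /\ t' <= t.

(** The answer is read off register 0. *)
Definition outputs_within (p : prog) (w : seq nat) (r : seq bool) (b : bool)
    (t : nat) : Prop :=
  exists s' r' t',
    [/\ exec p (init_state w) r s' r' t', t' <= t & (regs s' 0 != 0) = b].

(** A run of cost at most [t] tosses at most [t] coins, so [t] uniformly
    distributed random bits suffice.  The program has to stop within [t] for
    all their values, and to answer [b] except with probability at most 1/3. *)
Definition decides_within (p : prog) (w : seq nat) (b : bool) (t : nat) :
    Prop :=
  (forall r : t.-tuple bool, halts_within p w r t) /\
  3 * #|[set r : t.-tuple bool | ~~ `[< outputs_within p w r b t >] ]| <= 2 ^ t.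

(** * Decision problems with a size parameter *)

(** [L n w b]: the word [w] encodes an instance with parameter [n] whose
    answer is [b]. *)
Definition problem := nat -> seq nat -> bool -> Prop.

Definition computed_in_time (L : problem) (T : nat -> nat) : Prop :=
  exists p : prog, forall n w b, L n w b -> decides_within p w b (T n).

Definition computed_in_exp_time (R : realType) (L : problem) (eps : R) : Prop :=
  exists T : nat -> nat,
    ((fun n => (T n)%:R%R : R^o) =O_\oo
       (fun n => (2 `^ (eps * n%:R))%R : R^o))%classic /\
    computed_in_time L T.

(** * Encodings

    A finite set is presented by any of its duplicate-free listings, in any
    order, both for a family and for each of its members; hence the length of
    an encoding is polynomial in [n] for each fixed bound [k]. *)

Definition lists_family (T : finType) (F : {set {set T}}) (L : seq (seq T)) :
    bool :=
  all uniq L && perm_eq [seq [set x in l] | l <- L] (enum F).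

Definition encode_lists (n : nat) (L : seq (seq nat)) : seq nat :=
  n :: size L :: flatten [seq size l :: l | l <- L].

Definition encodes (n : nat) (T : finType) (code : T -> nat)
    (F : {set {set T}}) (w : seq nat) : Prop :=
  exists2 L : seq (seq T), lists_family F L &
    w = encode_lists n [seq map code l | l <- L].

Definition bounded_family (T : finType) (k : nat) (F : {set {set T}}) : bool :=
  [forall S in F, #|S| <= k].

(** * CNF formulas *)

(** [(i, true)] is the variable [i] and [(i, false)] its negation. *)
Definition literal (n : nat) := ('I_n * bool)%type.
Definition clause (n : nat) := {set literal n}.
Definition cnf (n : nat) := {set clause n}.

Definition literal_code (n : nat) (l : literal n) : nat := 2 * l.1 + ~~ l.2.

Definition satisfies (n : nat) (a : {ffun 'I_n -> bool}) (phi : cnf n) : bool :=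
  [forall C in phi, exists l in C, a l.1 == l.2].

Definition parity_cnf_sat (k : nat) : problem := fun n w b =>
  exists phi : cnf n,
    [/\ bounded_family k phi,
        encodes n (@literal_code n) phi w &
        b = odd #|[set a : {ffun 'I_n -> bool} | satisfies a phi]| ].

(** * Set families over a universe with [n] elements *)

Definition set_family (n : nat) := {set {set 'I_n}}.

Definition hitting_set (n : nat) (F : set_family n) (H : {set 'I_n}) : bool :=
  [forall S in F, H :&: S != finset.set0].

Definition parity_hitting_set (k : nat) : problem := fun n w b =>
  exists F : set_family n,
    [/\ bounded_family k F,
        encodes n (@nat_of_ord n) F w &
        b = odd #|[set H : {set 'I_n} | hitting_set F H]| ].

Definition set_cover (n : nat) (F C : set_family n) : bool :=
  (C \subset F) && (finset.cover C == [set: 'I_n]).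

Definition parity_set_cover (k : nat) : problem := fun n w b =>
  exists F : set_family n,
    [/\ bounded_family k F,
        encodes n (@nat_of_ord n) F w &
        b = odd #|[set C : set_family n | set_cover F C]| ].

(** * The parity strong exponential time hypothesis *)

Definition parity_SETH (R : realType) : Prop :=
  forall eps : R, (eps < 1)%R ->
    exists k : nat, ~ computed_in_exp_time (parity_cnf_sat k) eps.

(* Main.v *)
(** The number of pairs [(H, C)] with [C] a subfamily of [F] and [H] disjoint
    from the union of [C] has the parity of the number of hitting sets of [F],
    and also that of the number of its set covers, so the last two problems
    coincide.  Hitting sets are the models of a monotone formula.  Conversely,
    the variables of a formula are cut into blocks of constant length [beta],
    and the assignments of a block are encoded by subsets of one and the same
    size of a block of [q] elements, where [q / beta] is as close to 1 as
    desired.  Small sets forbid the subsets that are below a code or are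
    incomparable with all of them, and the falsified clauses; the strict
    supersets of codes cannot be forbidden by hitting constraints, but they
    come in pairs and cancel modulo 2.  To run both reductions on the machine,
    the functions of the input memory that can be computed in polynomial time
    are shown to be closed under bounded iteration, sums and quantifiers, so
    that it suffices to write each output cell as such a function. *)

From mathcomp Require Import all_boot all_order all_algebra.
From mathcomp Require Import all_classical all_reals all_analysis.
From mathcomp Require Import zify lra.
Require Import Defs.

Set Implicit Arguments.
Unset Strict Implicit.
Unset Printing Implicit Defensive.

Import Order.TTheory GRing.Theory Num.Theory.

Local Open Scope nat_scope.

(** Hitting sets are closed under supersets, so a property can be forbidden only if it is inherited
    by subsets. This shapes the gadget: the codes form an antichain, and what lies strictly below a
    code is excluded while nothing above it can be. An additional point of the block, contained in
    every code and ignored by the notion of junk, supplies the involution that cancels the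
    supersets. The rate comes from the largest binomial coefficient of [m], which is at least
    [2 ^ m / m.+1]: out of [q = m.+1] points only the additional one and about [log m] bits are
    wasted. The rate never reaches 1, but the hypothesis speaks about all exponents below 1, so an
    arbitrarily small loss is harmless. The gadget is obtained by counting, without an algorithm;
    its size is constant, however, so it enters the program as a finite table. Likewise every
    constraint involves boundedly many points, hence the family has polynomial size. *)

Lemma bitlen_le v : bitlen v <= v.+1.
Proof.
rewrite /bitlen ltnS; case: v => [|v]; first by rewrite trunc_log0.
exact/ltnW/(leq_trans (ltn_expl _ (ltnSn 1)))/trunc_logP.
Qed.

Lemma leq_bitlen v w : v <= w -> bitlen v <= bitlen w.
Proof. by move=> h; rewrite ltnS; apply: leq_trunc_log. Qed.

Lemma bitlen_exp v m : v <= 2 ^ m -> bitlen v <= m.+1.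
Proof. by move=> h; apply: (leq_trans (leq_bitlen h)); rewrite /bitlen trunc_expnK. Qed.

(* The sums of powers of [V] occurring as running times are absorbed into a
   single power, which is what [2 <= V] is for. *)
Lemma leq_exp_add V a b A B :
  2 <= V -> a <= V ^ A -> b <= V ^ B -> a + b <= V ^ (A + B).+1.
Proof.
move=> V2 ha hb; have V0 : 0 < V by apply: ltnW.
rewrite expnS (leq_trans (leq_add ha hb)) //.
rewrite (leq_trans _ (leq_mul V2 (leqnn _))) // mul2n -addnn leq_add //.
  by rewrite leq_pexp2l // leq_addr.
by rewrite leq_pexp2l // leq_addl.
Qed.

Lemma leq_exp_mul V a b A B :
  a <= V ^ A -> b <= V ^ B -> a * b <= V ^ (A + B).
Proof. by move=> ha hb; rewrite expnD leq_mul. Qed.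

Lemma leq_exp_cst V c : 2 <= V -> c <= V ^ c.
Proof.
move=> V2; apply: (leq_trans (ltnW (ltn_expl c (ltnSn 1)))).
by case: c => // c; rewrite leq_exp2r.
Qed.

Lemma leq_expW V a A B : 2 <= V -> A <= B -> a <= V ^ A -> a <= V ^ B.
Proof.
move=> V2 AB h; apply: leq_trans h _.
by rewrite leq_pexp2l //; apply: ltnW.
Qed.

Lemma leq_exp_gt0 V K : 2 <= V -> V <= V ^ K.+1.
Proof. by move=> V2; rewrite -{1}(expn1 V); apply: leq_expW (leqnn _). Qed.

Lemma leq_binop o V a b A B : 2 <= V -> a <= V ^ A -> b <= V ^ B ->
  binop_sem o a b <= V ^ (A + B).+1.
Proof.
move=> V2 ha hb; have hA : A <= (A + B).+1 by lia.
case: o => /=.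
- exact: leq_exp_add.
- apply: leq_trans (leq_subr _ _) _; exact: leq_expW ha.
- exact: leq_expW (leq_exp_mul ha hb).
- apply: leq_trans (leq_div _ _) _; exact: leq_expW ha.
Qed.

(** * Deterministic executions *)

Lemma exec_cat_coins p s r s' r' t q :
  exec p s r s' r' t -> exec p s (r ++ q) s' (r' ++ q) t.
Proof.
move=> H; elim: H; by move=> *; econstructor; eassumption.
Qed.

(** Fixing [t'] before [r] and returning [r] intact says that no coin is tossed: a reduction leaves
    all coins to the program that follows it. *)
Definition runs p s s' t := exists2 t', t' <= t & forall r, exec p s r s' r t'.

Lemma runs_leq p s s' t1 t2 : t1 <= t2 -> runs p s s' t1 -> runs p s s' t2.
Proof. by move=> h [t' ht H]; exists t' => //; apply: leq_trans h. Qed.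

Lemma runs_seq p1 p2 s0 s1 s2 t1 t2 :
  runs p1 s0 s1 t1 -> runs p2 s1 s2 t2 -> runs (Seq p1 p2) s0 s2 (t1 + t2).
Proof.
move=> [u1 h1 H1] [u2 h2 H2]; exists (u1 + u2); first exact: leq_add.
by move=> r; apply: exec_seq (H1 r) (H2 r).
Qed.

Lemma runs_assign x e s : runs (Assign x e) s (set_reg s x (eval s e)) (cost s e).
Proof. by exists (cost s e) => // r; constructor. Qed.

Lemma runs_store a e s :
  runs (Store a e) s (set_mem s (eval s a) (eval s e)) (cost s a + cost s e).
Proof. by exists (cost s a + cost s e) => // r; constructor. Qed.

Lemma runs_while (I : nat -> state -> Prop) N e p c t :
    (forall i s, i < N -> I i s ->
      [/\ eval s e != 0, cost s e <= c & exists2 s', runs p s s' t & I i.+1 s']) ->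
    (forall s, I N s -> eval s e = 0 /\ cost s e <= c) ->
  forall s, I 0 s -> exists2 s', runs (While e p) s s' (N * (c + t) + c) & I N s'.
Proof.
move=> step stop.
suff H m : forall i s, i + m = N -> I i s ->
    exists2 s', runs (While e p) s s' (m * (c + t) + c) & I N s'.
  by move=> s; apply: H.
elim: m => [|m IH] i s him.
  rewrite addn0 in him; rewrite him => /[dup] hI /stop [h0 hc].
  by exists s => //; exists (cost s e); rewrite ?mul0n // => r; apply: exec_while_stop.
have hi : i < N by rewrite -him; lia.
move=> /(step _ _ hi) [ne hc [s1 [t1 ht1 h1]]].
move=> /(IH i.+1); rewrite addSnnS => /(_ him) [s2 [t2 ht2 h2] hN].
exists s2 => //; exists (cost s e + t1 + t2); last first.
  by move=> r; apply: exec_while_step ne (h1 r) (h2 r).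
by rewrite mulSn -[_ + c]addnA leq_add // leq_add.
Qed.

(** * Polynomial-time functions *)

(* A context holds the contents of the memory and [k] bound numbers, which a
   program keeps in registers. *)
Fixpoint ctx k : Type := if k is k'.+1 then (ctx k' * nat)%type else (nat -> nat).

Fixpoint ctx_mem k : ctx k -> nat -> nat :=
  match k with 0 => fun g => g | k'.+1 => fun g => ctx_mem g.1 end.

Fixpoint ctx_vals k : ctx k -> seq nat :=
  match k with 0 => fun=> [::] | k'.+1 => fun g => g.2 :: ctx_vals g.1 end.

Definition bounded k (g : ctx k) V :=
  (forall a, ctx_mem g a <= V) /\ all (fun v => v <= V) (ctx_vals g).

Definition reads k (g : ctx k) (rho : seq nat) s :=
  memory s = ctx_mem g /\ [seq regs s x | x <- rho] = ctx_vals g.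

Definition agree d s s' := memory s' = memory s /\ {in gtn d, regs s' =1 regs s}.

Definition poly_bounded k (f : ctx k -> nat) :=
  exists K, forall g V, 2 <= V -> bounded g V -> f g <= V ^ K.

(* The registers from [d] on are scratch space, and [V] bounds all the numbers
   that [f] can see. *)
Definition evaluates k (f : ctx k -> nat) rho d p K :=
  forall g s V, 2 <= V -> bounded g V -> reads g rho s ->
  exists s', [/\ runs p s s' (V ^ K), regs s' d = f g & agree d s s'].

(** The bound on the values belongs to the notion because a composite is run in a context enlarged
    by an intermediate value; its running time stays a power of [V] only if that value is one. Every
    choice of registers is allowed, so that programs can be nested. *)
Definition cmp k (f : ctx k -> nat) :=
  poly_bounded f /\
  forall rho d, all (gtn d) rho -> exists p K, evaluates f rho d p K.

Arguments cmp : clear implicits.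
Arguments poly_bounded : clear implicits.

Lemma boundedW k (g : ctx k) V W : V <= W -> bounded g V -> bounded g W.
Proof.
move=> h [h1 h2]; split=> [a|]; first exact: leq_trans (h1 a) h.
by apply: sub_all h2 => x hx; apply: leq_trans hx h.
Qed.

Lemma bounded_push k (g : ctx k) v V K :
  2 <= V -> bounded g V -> v <= V ^ K.+1 -> bounded (k := k.+1) (g, v) (V ^ K.+1).
Proof.
move=> V2 hg hv; have [h1 h2] := boundedW (leq_exp_gt0 K V2) hg.
by split=> //=; rewrite hv.
Qed.

Lemma agree_trans d s1 s2 s3 : agree d s1 s2 -> agree d s2 s3 -> agree d s1 s3.
Proof.
move=> [e1 h1] [e2 h2]; split; first by rewrite e2.
by move=> x hx; rewrite h2 ?h1.
Qed.

Lemma agreeW d d' s s' : d <= d' -> agree d' s s' -> agree d s s'.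
Proof. by move=> h [e1 h1]; split=> // x hx; apply: h1; apply: leq_trans hx h. Qed.

Lemma agree_set_reg d s x v : d <= x -> agree d s (set_reg s x v).
Proof.
move=> h; split=> // y; rewrite inE /= => hy.
by case: eqP => // e; move: hy; rewrite e ltnNge h.
Qed.

Lemma agree_reads k (g : ctx k) rho d s s' :
  all (gtn d) rho -> agree d s s' -> reads g rho s -> reads g rho s'.
Proof.
move=> hrho [e h] [em er]; split; first by rewrite e.
rewrite -er; apply/eq_in_map => x hx; apply: h.
by rewrite inE; apply: (allP hrho).
Qed.

Lemma reads_push k (g : ctx k) v rho x s :
  reads g rho s -> regs s x = v -> reads (k := k.+1) (g, v) (x :: rho) s.
Proof. by move=> [e1 e2] h; split=> //=; rewrite h e2. Qed.

Lemma all_gtnW d d' rho : d <= d' -> all (gtn d) rho -> all (gtn d') rho.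
Proof. by move=> h; apply: sub_all => x hx; apply: leq_trans hx h. Qed.

(** Bit lengths are replaced by the values themselves. This crude estimate suffices as long as all
    numbers are polynomial in the input parameter. *)
Lemma bitlen_exp_le V v K : 2 <= V -> v <= V ^ K -> bitlen v <= V ^ K.+2.
Proof.
move=> V2 h; apply: leq_trans (bitlen_le v) _; rewrite -addn1.
have h1 : 1 <= V ^ 0 by [].
by apply: leq_expW (leq_exp_add V2 h h1) => //; lia.
Qed.

(** Adding the three bit lengths gives the exponent [2 * (K + L) + 9]; the stated one is a round
    upper bound. *)
Lemma cost_le2 o x y s V K L :
  2 <= V -> regs s x <= V ^ K -> regs s y <= V ^ L ->
  cost s (Bin o (Reg x) (Reg y)) <= V ^ (4 * (K + L) + 20).
Proof.
move=> V2 hx hy; rewrite /= !addn0.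
have hb := leq_binop o V2 hx hy.
have := leq_exp_add V2 (bitlen_exp_le V2 hb)
  (leq_exp_add V2 (bitlen_exp_le V2 hx) (bitlen_exp_le V2 hy)).
by apply: leq_expW => //; clear; lia.
Qed.

Lemma cmp_cst k c : cmp k (fun=> c).
Proof.
split; first by exists c => g V V2 _; apply: leq_exp_cst.
move=> rho d _; exists (Assign d (Cst c)), c.+2 => g s V V2 _ _.
exists (set_reg s d c); split; last exact: agree_set_reg.
  apply: runs_leq (runs_assign _ _ _); rewrite /= addn0.
  exact/bitlen_exp_le/leq_exp_cst.
by rewrite /= eqxx.
Qed.

Lemma cmp_var k : cmp k.+1 (fun g => g.2).
Proof.
split; first by exists 1 => g V V2 [_ /= /andP[h _]]; rewrite expn1.
move=> [|x rho] d h.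
  (* An empty register list cannot hold a nonempty context, so [reads] is contradictory here. *)
  by exists Skip, 0 => g s V _ _ [].
exists (Assign d (Reg x)), 3 => g s V V2 [_ /= /andP[hb _]] [e1 /= [e2 _]].
exists (set_reg s d (regs s x)); split; last exact: agree_set_reg.
  apply: runs_leq (runs_assign _ _ _); rewrite /= addn0.
  by apply: bitlen_exp_le => //; rewrite e2 expn1.
by rewrite /= eqxx.
Qed.

Lemma cmp_weaken k (f : ctx k -> nat) : cmp k f -> cmp k.+1 (fun g => f g.1).
Proof.
move=> [[K hK] h]; split.
  by exists K => g V V2 [h1 /= /andP[_ h2]]; apply: hK.
move=> [|x rho] d.
  by exists Skip, 0 => g s V _ _ [].
move=> /andP[_ /h[p [L hp]]]; exists p, L => g s V V2 [h1 /= /andP[_ h2]] [e1 [_ e2]].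
exact: hp.
Qed.

Lemma cmp_weaken_under k (f : ctx k.+1 -> nat) :
  cmp k.+1 f -> cmp k.+2 (fun g => f (g.1.1, g.2)).
Proof.
move=> [[K hK] h]; split.
  exists K => g V V2 [h1 /= /and3P[h2 _ h3]]; apply: hK => //.
  by split=> //=; rewrite h2.
move=> [|x [|y rho]] d; try by exists Skip, 0 => g s V _ _ [].
move=> /and3P[hx _ hr]; have [|p [L hp]] := h (x :: rho) d; first by apply/andP.
exists p, L => g s V V2 [h1 /= /and3P[h2 _ h3]] [e1 [e2 _ e3]].
by apply: hp => //; split=> //=; rewrite ?h2 ?e2 ?e3.
Qed.

Lemma cmp_let k (f : ctx k -> nat) (F : ctx k.+1 -> nat) :
  cmp k f -> cmp k.+1 F -> cmp k (fun g => F (g, f g)).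
Proof.
move=> [[K hK] hf] [[L hL] hF].
(* The exponent [K.+1] instead of [K] makes the power bound the old context as well, even when
   [K = 0]; it then takes the place of [V] for [F], so that exponents multiply. *)
have hK' g V : 2 <= V -> bounded g V -> f g <= V ^ K.+1.
  by move=> V2 hg; apply: leq_expW (hK _ _ V2 hg).
have V2' V : 2 <= V -> 2 <= V ^ K.+1.
  by move=> V2; rewrite (leq_trans V2) // leq_exp_gt0.
split.
  exists (K.+1 * L) => g V V2 hg; rewrite expnM.
  by apply: hL; [exact: V2'|apply: bounded_push => //; apply: hK'].
move=> rho d hd; have [p [A hp]] := hf rho d hd.
have [|q [B hq]] := hF (d :: rho) d.+1.
  by rewrite /= ltnSn; apply: all_gtnW hd.
exists (Seq p (Seq q (Assign d (Reg d.+1)))), (A + (K.+1 * B + (K.+1 * L).+2).+1).+1.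
move=> g s V V2 hg hr.
have [s1 [r1 e1 a1]] := hp _ _ _ V2 hg hr.
have hb : bounded (k := k.+1) (g, f g) (V ^ K.+1).
  by apply: bounded_push => //; apply: hK'.
have [|s2 [r2 e2 a2]] := hq (g, f g) s1 _ (V2' _ V2) hb.
  by apply: reads_push => //; exact: agree_reads hd a1 hr.
exists (set_reg s2 d (regs s2 d.+1)); split.
- apply: runs_leq (runs_seq r1 (runs_seq r2 (runs_assign _ _ _))).
  apply: leq_exp_add => //; apply: leq_exp_add => //; first by rewrite expnM.
  rewrite /= addn0; apply: bitlen_exp_le => //.
  by rewrite e2 expnM; apply: hL => //; apply: V2'.
- by rewrite /= eqxx.
- apply: agree_trans a1 _; apply: agree_trans (agreeW (leqnSn d) a2) _.
  exact: agree_set_reg.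
Qed.

Lemma cmp_mem k (f : ctx k -> nat) : cmp k f -> cmp k (fun g => ctx_mem g (f g)).
Proof.
move=> [[K hK] hf]; split.
  by exists 1 => g V V2 [h _]; rewrite expn1.
move=> rho d hd; have [p [A hp]] := hf rho d hd.
exists (Seq p (Assign d (Mem (Reg d)))), (A + (K.+2 + 3).+1).+1.
move=> g s V V2 hg hr; have [s1 [r1 e1 a1]] := hp _ _ _ V2 hg hr.
exists (set_reg s1 d (memory s1 (regs s1 d))); split.
- apply: runs_leq (runs_seq r1 (runs_assign _ _ _)).
  apply: leq_exp_add => //=; rewrite addn0 addnC; apply: leq_exp_add => //.
    by apply: bitlen_exp_le => //; rewrite e1; apply: hK.
  apply: bitlen_exp_le => //; rewrite expn1.
  by case: a1 => -> _; case: hr => -> _; case: hg.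
- by rewrite /= eqxx e1; case: a1 => -> _; case: hr => ->.
- by apply: agree_trans a1 _; apply: agree_set_reg.
Qed.

Lemma cmp_bin k o (f1 f2 : ctx k -> nat) :
  cmp k f1 -> cmp k f2 -> cmp k (fun g => binop_sem o (f1 g) (f2 g)).
Proof.
move=> [[K1 hK1] h1] [[K2 hK2] h2]; split.
  exists (K1 + K2).+1 => g V V2 hg.
  have hx := hK1 _ _ V2 hg; have hy := hK2 _ _ V2 hg.
  exact: leq_binop.
move=> rho d hd; have [p [A hp]] := h1 rho d hd.
have [q [B hq]] := h2 rho d.+1 (all_gtnW (leqnSn d) hd).
exists (Seq p (Seq q (Assign d (Bin o (Reg d) (Reg d.+1))))),
  (A + (B + (4 * (K1 + K2) + 20)).+1).+1.
move=> g s V V2 hg hr; have [s1 [r1 e1 a1]] := hp _ _ _ V2 hg hr.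
have [s2 [r2 e2 a2]] := hq _ _ _ V2 hg (agree_reads hd a1 hr).
have e1' : regs s2 d = f1 g by case: a2 => _ ->; rewrite ?inE.
exists (set_reg s2 d (eval s2 (Bin o (Reg d) (Reg d.+1)))); split.
- apply: runs_leq (runs_seq r1 (runs_seq r2 (runs_assign _ _ _))).
  apply: leq_exp_add => //; apply: leq_exp_add => //.
  by apply: cost_le2 => //; rewrite ?e1' ?e2; [apply: hK1|apply: hK2].
- by rewrite /= eqxx e1' e2.
- apply: agree_trans a1 _; apply: agree_trans (agreeW (leqnSn d) a2) _.
  exact: agree_set_reg.
Qed.

(** The bound on all iterates has to be assumed: repeating a polynomial step such as squaring leaves
    the polynomially bounded functions. *)
Lemma cmp_iteri k (N f0 : ctx k -> nat) (F : ctx k -> nat -> nat -> nat) :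
    cmp k N -> cmp k f0 -> cmp k.+2 (fun g => F g.1.1 g.1.2 g.2) ->
    (exists K, forall g V, 2 <= V -> bounded g V ->
       forall i, i <= N g -> iteri i (F g) (f0 g) <= V ^ K) ->
  cmp k (fun g => iteri (N g) (F g) (f0 g)).
Proof.
move=> [[K0 hK0] hN] [_ hf] [_ hF] [L0 hL0].
pose K := (K0 + L0); have hK g V : 2 <= V -> bounded g V -> N g <= V ^ K.+1.
  by move=> V2 hg; apply: leq_expW (hK0 _ _ V2 hg) => //; rewrite /K; clear; lia.
have hL g V : 2 <= V -> bounded g V -> forall i, i <= N g -> iteri i (F g) (f0 g) <= V ^ K.+1.
  by move=> V2 hg i hi; apply: leq_expW (hL0 _ _ V2 hg i hi) => //; rewrite /K; clear; lia.
have V2' V : 2 <= V -> 2 <= V ^ K.+1.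
  by move=> V2; rewrite (leq_trans V2) // leq_exp_gt0.
split; first by exists K.+1 => g V V2 hg; apply: hL.
move=> rho d hd.
have [p [A hp]] := hN rho d hd.
have [q [B hq]] := hf rho d.+1 (all_gtnW (leqnSn d) hd).
have [|w [C hw]] := hF [:: d.+1, d.+2 & rho] d.+3.
  by rewrite /= !ltnS leqnSn leqnn; apply: all_gtnW hd; clear; lia.
(* Register [d] holds the number of rounds, [d.+1] the current iterate, [d.+2] the round counter,
   and [d.+3] receives the value of [F]. Truncated subtraction serves as the test for [i < N g]. *)
pose E := Bin Sub (Reg d) (Reg d.+2).
pose body := Seq w (Seq (Assign d.+1 (Reg d.+3)) (Assign d.+2 (Bin Add (Reg d.+2) (Cst 1)))).
pose D := 4 * (K.+1 + K.+1) + 20.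
pose T := (K.+1 * C + (K.+3 + D).+1).+1.
exists (Seq p (Seq q (Seq (Assign d.+2 (Cst 0)) (Seq (While E body) (Assign d (Reg d.+1)))))).
exists (A + (B + (3 + (((K.+1 + (D + T).+1) + D).+1 + K.+3).+1).+1).+1).+1.
move=> g s V V2 hg hr.
have [s1 [r1 e1 a1]] := hp _ _ _ V2 hg hr.
have [s2 [r2 e2 a2]] := hq _ _ _ V2 hg (agree_reads hd a1 hr).
have e1' : regs s2 d = N g by case: a2 => _ ->; rewrite ?inE.
have a12 : agree d s s2 by apply: agree_trans a1 (agreeW (leqnSn d) a2).
pose I i (u : state) := [/\ agree d s u, regs u d = N g, regs u d.+2 = i
  & regs u d.+1 = iteri i (F g) (f0 g)].
have costE u i : i <= N g -> I i u -> cost u E <= V ^ D.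
  by move=> hi [_ ed ei _]; apply: cost_le2 => //; rewrite ?ed ?ei ?(leq_trans hi) // hK.
have [|||u ru Iu] := @runs_while I (N g) E body (V ^ D) (V ^ T) _ _
    (set_reg s2 d.+2 0).
- move=> i u hi Iiu; split.
  + by case: Iiu => _ /= -> -> _; rewrite subn_eq0 -ltnNge.
  + by apply: costE Iiu; apply: ltnW.
  have [au ed ei ey] := Iiu.
  have hb : bounded (k := k.+2) (g, i, iteri i (F g) (f0 g)) (V ^ K.+1).
    have hg' := boundedW (leq_exp_gt0 K V2) hg.
    case: hg' => h1 h2; split=> //=; rewrite hL ?(ltnW hi) //=.
    by rewrite (leq_trans (ltnW hi)) // hK.
  have [|u1 [ru1 eu1 au1]] := hw (g, i, iteri i (F g) (f0 g)) u _ (V2' _ V2) hb.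
    by apply: reads_push => //; apply: reads_push => //; exact: agree_reads hd au hr.
  have au1' := au1; case: au1' => _ au1'.
  set u2 := set_reg u1 d.+1 (regs u1 d.+3).
  set u3 := set_reg u2 d.+2 (regs u2 d.+2 + 1).
  have ei2 : regs u2 d.+2 = i.
    by rewrite /u2 /= (gtn_eqF (ltnSn d.+1)) au1' ?inE.
  exists u3.
    apply: runs_leq (runs_seq ru1 (runs_seq (runs_assign _ _ _) (runs_assign _ _ _))).
    apply: leq_exp_add => //; first by rewrite expnM.
    apply: leq_exp_add => //.
      rewrite /= addn0; apply: bitlen_exp_le => //.
      by rewrite eu1 /= (hL _ _ V2 hg i.+1).
    rewrite -[X in cost X]/u2.
    have -> : cost u2 (Bin Add (Reg d.+2) (Cst 1)) =
       bitlen (i + 1) + (bitlen i + bitlen 1).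
      change (bitlen (regs u2 d.+2 + 1) + ((bitlen (regs u2 d.+2) + 0) + (bitlen 1 + 0))
        = bitlen (i + 1) + (bitlen i + bitlen 1)).
      by rewrite ei2 !addn0.
    have hi1 : i + 1 <= V ^ K.+1 by rewrite addn1 (leq_trans hi) // hK.
    have hi0 : i <= V ^ K.+1 by rewrite (leq_trans _ hi1) // leq_addr.
    have b1 : 1 <= V ^ 0 by [].
    have := leq_exp_add V2 (bitlen_exp_le V2 hi1)
      (leq_exp_add V2 (bitlen_exp_le V2 hi0) (bitlen_exp_le V2 b1)).
    by apply: leq_expW => //; rewrite /D; clear; lia.
  split.
  + apply: agree_trans au _; apply: agree_trans (agreeW _ au1) _; first by clear; lia.
    by apply: (@agree_trans _ _ u2); apply: agree_set_reg; clear; lia.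
  + rewrite /u3 /u2 /=.
    rewrite (ltn_eqF (_ : d < d.+2)) ?(ltn_eqF (ltnSn d)) ?au1' ?inE //; clear; lia.
  + change ((if d.+2 == d.+2 then regs u2 d.+2 + 1 else regs u2 d.+2) = i.+1).
    by rewrite eqxx ei2 addn1.
  + by rewrite /u3 /= (ltn_eqF (ltnSn d.+1)) eqxx eu1.
- move=> u Iu; split; last by apply: costE Iu.
  by case: Iu => _ /= -> -> _; rewrite subnn.
- split.
  + by apply: agree_trans a12 _; apply: agree_set_reg; clear; lia.
  + by rewrite /= (ltn_eqF (_ : d < d.+2)) ?e1' //; clear; lia.
  + by rewrite /= eqxx.
  + by rewrite /= (ltn_eqF (ltnSn d.+1)) e2.
case: Iu => au _ _ ey.
exists (set_reg u d (regs u d.+1)); split.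
- apply: runs_leq (runs_seq r1 (runs_seq r2 (runs_seq (runs_assign _ (Cst 0) _)
    (runs_seq ru (runs_assign _ (Reg _) _))))).
  do 2 apply: leq_exp_add => //.
  apply: leq_exp_add => //.
    by rewrite /= addn0 (@bitlen_exp_le V 0 1).
  apply: leq_exp_add => //.
    apply: leq_exp_add => //.
    apply: leq_exp_mul; first exact: hK.
    exact: leq_exp_add.
  by rewrite /= addn0; apply: bitlen_exp_le => //; rewrite ey hL.
- by rewrite /= eqxx ey.
- by apply: agree_trans au _; apply: agree_set_reg.
Qed.

Lemma cmp_eq k (f f' : ctx k -> nat) : f =1 f' -> cmp k f' -> cmp k f.
Proof. by move=> /funext ->. Qed.

Lemma cmpD k (f1 f2 : ctx k -> nat) :
  cmp k f1 -> cmp k f2 -> cmp k (fun g => f1 g + f2 g).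
Proof. exact: (@cmp_bin _ Add). Qed.

Lemma cmpS k (f : ctx k -> nat) : cmp k f -> cmp k (fun g => (f g).+1).
Proof.
move=> h; apply: (@cmp_eq _ _ (fun g => f g + 1)); first by move=> g; rewrite addn1.
by apply: cmpD => //; exact: cmp_cst.
Qed.

Lemma cmpB k (f1 f2 : ctx k -> nat) :
  cmp k f1 -> cmp k f2 -> cmp k (fun g => f1 g - f2 g).
Proof. exact: (@cmp_bin _ Sub). Qed.

Lemma cmpM k (f1 f2 : ctx k -> nat) :
  cmp k f1 -> cmp k f2 -> cmp k (fun g => f1 g * f2 g).
Proof. exact: (@cmp_bin _ Mul). Qed.

Lemma cmp_divn k (f1 f2 : ctx k -> nat) :
  cmp k f1 -> cmp k f2 -> cmp k (fun g => f1 g %/ f2 g).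
Proof. exact: (@cmp_bin _ Div). Qed.

Lemma cmp_modn k (f1 f2 : ctx k -> nat) :
  cmp k f1 -> cmp k f2 -> cmp k (fun g => f1 g %% f2 g).
Proof.
move=> h1 h2; apply: (@cmp_eq _ _ (fun g => f1 g - f1 g %/ f2 g * f2 g)).
  by move=> g; rewrite {2}(divn_eq (f1 g) (f2 g)) addKn.
by apply: cmpB => //; apply: cmpM => //; apply: cmp_divn.
Qed.

Definition cmpb k (b : ctx k -> bool) := cmp k (fun g => b g : nat).
Arguments cmpb : clear implicits.

Lemma cmpb_eq k (b b' : ctx k -> bool) : b =1 b' -> cmpb k b' -> cmpb k b.
Proof. by move=> /funext ->. Qed.

Lemma cmpb_leq k (f1 f2 : ctx k -> nat) :
  cmp k f1 -> cmp k f2 -> cmpb k (fun g => f1 g <= f2 g).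
Proof.
move=> h1 h2; apply: (@cmp_eq _ _ (fun g => 1 - (f1 g - f2 g))).
  by move=> g; rewrite /leq; case: (_ - _).
by apply: cmpB; [exact: cmp_cst|exact: cmpB].
Qed.

Lemma cmpb_ltn k (f1 f2 : ctx k -> nat) :
  cmp k f1 -> cmp k f2 -> cmpb k (fun g => f1 g < f2 g).
Proof.
move=> h1 h2; apply: (@cmpb_eq _ _ (fun g => f1 g + 1 <= f2 g)).
  by move=> g; rewrite addn1.
by apply: cmpb_leq => //; apply: cmpD => //; apply: cmp_cst.
Qed.

Lemma cmpb_not k (b : ctx k -> bool) : cmpb k b -> cmpb k (fun g => ~~ b g).
Proof.
move=> h; apply: (@cmp_eq _ _ (fun g => 1 - b g)); first by move=> g; case: (b g).
by apply: cmpB => //; exact: cmp_cst.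
Qed.

Lemma cmpb_and k (b1 b2 : ctx k -> bool) :
  cmpb k b1 -> cmpb k b2 -> cmpb k (fun g => b1 g && b2 g).
Proof.
move=> h1 h2; apply: (@cmp_eq _ _ (fun g => b1 g * b2 g)); last exact: cmpM.
by move=> g; rewrite mulnb.
Qed.

Lemma cmpb_or k (b1 b2 : ctx k -> bool) :
  cmpb k b1 -> cmpb k b2 -> cmpb k (fun g => b1 g || b2 g).
Proof.
move=> h1 h2; apply: (@cmpb_eq _ _ (fun g => ~~ (~~ b1 g && ~~ b2 g))).
  by move=> g; rewrite negb_and !negbK.
by apply: cmpb_not; apply: cmpb_and; apply: cmpb_not.
Qed.

Lemma cmpb_eqn k (f1 f2 : ctx k -> nat) :
  cmp k f1 -> cmp k f2 -> cmpb k (fun g => f1 g == f2 g).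
Proof.
move=> h1 h2; apply: (@cmpb_eq _ _ (fun g => (f1 g <= f2 g) && (f2 g <= f1 g))).
  by move=> g; rewrite eqn_leq.
by apply: cmpb_and; apply: cmpb_leq.
Qed.

Lemma cmp_if k (b : ctx k -> bool) (f1 f2 : ctx k -> nat) :
  cmpb k b -> cmp k f1 -> cmp k f2 -> cmp k (fun g => if b g then f1 g else f2 g).
Proof.
move=> hb h1 h2; apply: (@cmp_eq _ _ (fun g => b g * f1 g + (1 - b g) * f2 g)).
  by move=> g; case: (b g); rewrite ?mul1n ?mul0n ?addn0.
by apply: cmpD; apply: cmpM => //; apply: cmpB => //; apply: cmp_cst.
Qed.

Lemma cmp_sum k (N : ctx k -> nat) (F : ctx k -> nat -> nat) :
  cmp k N -> cmp k.+1 (fun p => F p.1 p.2) -> cmp k (fun g => \sum_(i < N g) F g i).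
Proof.
move=> hN hF.
have sumE g n : iteri n (fun i y => y + F g i) 0 = \sum_(i < n) F g i.
  by elim: n => [|n IH] /=; rewrite ?big_ord0 // big_ord_recr /= IH.
apply: (@cmp_eq _ _ (fun g => iteri (N g) (fun i y => y + F g i) 0)).
  by move=> g; rewrite sumE.
apply: (@cmp_iteri _ _ (fun=> 0) (fun g i y => y + F g i)) => //.
- exact: cmp_cst.
- by apply: cmpD; [exact: cmp_var|exact: cmp_weaken hF].
have [[K hK] _] := hN; have [[L hL] _] := hF.
exists (K + K.+1 * L) => g V V2 hg i hi; rewrite sumE.
have hK' : N g <= V ^ K.+1 by apply: leq_expW (hK _ _ V2 hg).
have V2' : 2 <= V ^ K.+1 by rewrite (leq_trans V2) // leq_exp_gt0.
apply: (@leq_trans (\sum_(j < i) V ^ (K.+1 * L))).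
  apply: leq_sum => j _; rewrite expnM.
  apply: (hL (g, nat_of_ord j)) => //; apply: bounded_push => //.
  by apply: leq_trans hK'; apply: ltnW; apply: leq_trans hi.
rewrite sum_nat_const card_ord expnD leq_mul //.
by apply: leq_trans hi _; apply: hK.
Qed.

Lemma cmpb_exists k (N : ctx k -> nat) (P : ctx k -> nat -> bool) :
  cmp k N -> cmpb k.+1 (fun p => P p.1 p.2) ->
  cmpb k (fun g => [exists i : 'I_(N g), P g i]).
Proof.
move=> hN hP; apply: (@cmpb_eq _ _ (fun g => 0 < \sum_(i < N g) P g i)).
  move=> g; rewrite lt0n sum_nat_eq0 negb_forall.
  by apply: eq_existsb => i; rewrite /= eqb0 negbK.
apply: cmpb_ltn; first exact: cmp_cst.
exact: (@cmp_sum _ N (fun g i => P g i : nat)).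
Qed.

Lemma cmpb_forall k (N : ctx k -> nat) (P : ctx k -> nat -> bool) :
  cmp k N -> cmpb k.+1 (fun p => P p.1 p.2) ->
  cmpb k (fun g => [forall i : 'I_(N g), P g i]).
Proof.
move=> hN hP; apply: (@cmpb_eq _ _ (fun g => ~~ [exists i : 'I_(N g), ~~ P g i])).
  by move=> g; rewrite negb_exists; apply: eq_forallb => i; rewrite negbK.
apply/cmpb_not/(@cmpb_exists _ _ (fun g i => ~~ P g i)) => //.
exact: cmpb_not.
Qed.

(** With the exponent capped by the constant [J] the power is at most [V ^ (K * J)]; an unrestricted
    exponent would violate [poly_bounded]. *)
Lemma cmp_expn_minn k J (f e : ctx k -> nat) :
  cmp k f -> cmp k e -> cmp k (fun g => f g ^ minn (e g) J).
Proof.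
move=> hf he.
have expE a n : iteri n (fun _ y => y * a) 1 = a ^ n.
  by elim: n => [|n IH] //=; rewrite IH expnS mulnC.
apply: (@cmp_eq _ _ (fun g => iteri (minn (e g) J) (fun _ y => y * f g) 1)).
  by move=> g; rewrite expE.
apply: (@cmp_iteri _ _ (fun=> 1) (fun g i y => y * f g)).
- apply: (@cmp_eq _ _ (fun g => if e g < J then e g else J)).
    by move=> g; rewrite /minn.
  by apply: cmp_if => //; [apply: cmpb_ltn => //|]; apply: cmp_cst.
- exact: cmp_cst.
- by apply: cmpM; [exact: cmp_var|exact: cmp_weaken (cmp_weaken hf)].
have [[K hK] _] := hf.
exists (K * J) => g V V2 hg i hi; rewrite expE.
apply: (@leq_trans ((V ^ K) ^ i)).
  by case: i hi => // i _; rewrite leq_exp2r // hK.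
rewrite -expnM leq_pexp2l ?(ltnW V2) // leq_mul //.
by apply: leq_trans hi _; apply: geq_minr.
Qed.

(** The list [l] is fixed, so an arbitrary [Phi] becomes a decision tree of constant size. In this
    way a gadget that is only known to exist gets built into a program. *)
Lemma cmp_bits k (Phi : seq bool -> nat) (m : ctx k -> nat -> bool) (l : seq nat) :
    cmpb k.+1 (fun p => m p.1 p.2) ->
  cmp k (fun g => Phi [seq m g e | e <- l]).
Proof.
move=> hm; elim: l Phi => [|e l IH] Phi /=; first exact: cmp_cst.
apply: (@cmp_eq _ _ (fun g => if m g e then Phi (true :: [seq m g e | e <- l])
                              else Phi (false :: [seq m g e | e <- l]))).
  by move=> g; case: (m g e).
apply: cmp_if; [|exact: (IH (fun s => Phi (true :: s)))|exact: (IH (fun s => Phi (false :: s)))].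
exact: (@cmp_let _ (fun=> e) (fun p => m p.1 p.2) (cmp_cst _ _)).
Qed.

Lemma cmp_finset k q (Phi : {set 'I_q} -> nat) (m : ctx k -> nat -> bool) :
    cmpb k.+1 (fun p => m p.1 p.2) ->
  cmp k (fun g => Phi [set e : 'I_q | m g e]).
Proof.
move=> hm; pose Psi (s : seq bool) := Phi [set e : 'I_q | nth false s e].
apply: (@cmp_eq _ _ (fun g => Psi [seq m g e | e <- iota 0 q])); last exact: cmp_bits.
move=> g; congr Phi; apply/setP => e; rewrite !inE.
by rewrite (nth_map 0) ?size_iota // nth_iota.
Qed.

(** A cascade of [J] tests; the [F j] need programs one by one, not uniformly in [j]. *)
Lemma cmp_cases k J (f : ctx k -> nat) (F : nat -> ctx k -> nat) :
    cmp k f -> (forall j, j < J -> cmp k (F j)) ->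
  cmp k (fun g => if f g < J then F (f g) g else 0).
Proof.
move=> hf; elim: J => [|J IH] hF; first exact: cmp_cst.
apply: (@cmp_eq _ _ (fun g => if f g == J then F J g
                              else if f g < J then F (f g) g else 0)).
  by move=> g; rewrite ltnS leq_eqVlt; case: eqP => [->|].
apply: cmp_if; first by apply: cmpb_eqn => //; apply: cmp_cst.
  exact: hF.
by apply: IH => j hj; apply: hF; apply: leqW.
Qed.

(** The program run after a reduction expects the zero registers of [init_state]. Only registers
    below this bound can have changed, so finitely many assignments restore them. *)
Fixpoint reg_bound p : nat :=
  match p with
  | Skip | Store _ _ => 0
  | Assign x _ | Toss x => x.+1
  | Seq p1 p2 | If _ p1 p2 => maxn (reg_bound p1) (reg_bound p2)
  | While _ p => reg_bound p
  end.

Lemma exec_reg_bound p s r s' r' t :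
  exec p s r s' r' t -> forall x, reg_bound p <= x -> regs s' x = regs s x.
Proof.
move=> H; elim: H => //=.
- by move=> y e s0 _ x /gtn_eqF ->.
- by move=> y s0 b _ x /gtn_eqF ->.
- by move=> > _ IH1 _ IH2 x; rewrite geq_max => /andP[h1 h2]; rewrite IH2 ?IH1.
- by move=> e p1 p2 s0 > _ IH x; rewrite geq_max => /andP[h1 h2]; rewrite IH //; case: ifP.
- by move=> > _ _ IH1 _ IH2 x h; rewrite IH2 ?IH1.
Qed.

Fixpoint clear_regs m : prog :=
  if m is m'.+1 then Seq (Assign m' (Cst 0)) (clear_regs m') else Skip.

Lemma runs_clear_regs m s :
  runs (clear_regs m) s (State (fun x => if x < m then 0 else regs s x) (memory s)) m.+1.
Proof.
elim: m s => [|m IH] s /=.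
  exists 1 => // r; have -> : State (regs s) (memory s) = s by case: s.
  exact: exec_skip.
have -> : State (fun x => if x < m.+1 then 0 else regs s x) (memory s) =
    State (fun x => if x < m then 0 else regs (set_reg s m 0) x) (memory (set_reg s m 0)).
  by congr State; apply/funext => x /=; rewrite ltnS leq_eqVlt; case: eqP => [->|] //; rewrite ltnn.
by apply: runs_leq (runs_seq (runs_assign _ (Cst 0) _) (IH _)); rewrite /= /bitlen trunc_log0.
Qed.

(** * Positional notation *)

Definition undig B (l : seq nat) := foldr (fun d a => d + B * a) 0 l.

Lemma undig_lt B l : all (gtn B) l -> undig B l < B ^ size l.
Proof.
elim: l => //= d l IH /andP[hd /IH h]; rewrite expnS.
apply: (@leq_trans (B * (undig B l).+1)); first by rewrite mulnS ltn_add2r.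
by rewrite leq_mul2l h orbT.
Qed.

Lemma undig_leq B l m : 0 < B -> all (gtn B) l -> size l <= m -> undig B l <= B ^ m.
Proof.
move=> B0 h hs; apply: leq_trans (ltnW (undig_lt h)) _.
by rewrite leq_pexp2l.
Qed.

(** * Reductions *)

(* All the cells of the output are first packed into one number in base [B],
   since the input has to remain in place until the last of them is known. *)
Lemma runs_rewrite_memory (len : ctx 0 -> nat) (out : ctx 1 -> nat) :
    cmp 0 len -> cmp 1 out ->
  exists p K, forall w w' V, 2 <= V -> all (fun v => v <= V) w ->
    size w <= len (nth 0 w) -> size w' <= len (nth 0 w) ->
    (forall i, i < len (nth 0 w) -> out (nth 0 w, i) = nth 0 w' i) ->
  runs p (init_state w) (init_state w') (V ^ K).
Proof.
move=> hlen hout.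
(* Any number above all output cells can serve as the base; this one is available from closure under
   sums. *)
pose base (g : ctx 0) := 1 + \sum_(i < len g) out (g, nat_of_ord i).
have hbase : cmp 0 base.
  apply: cmpD; first exact: cmp_cst.
  apply: (@cmp_sum 0 len (fun g i => out (g, i))) => //.
  by apply: cmp_eq hout => -[].
(* Register layout: 0 for the length, 1 for the base, 2 for the packed number, 3 for the current
   index, 4 for the current output cell. *)
have [[Kl bl] /(_ [::] 0 isT) [pl [Tl hpl]]] := hlen.
have [[Kb bb] /(_ [::] 1 isT) [pb [Tb hpb]]] := hbase.
have [_ /(_ [:: 3] 4 isT) [po [To hpo]]] := hout.
(* Packing proceeds by Horner's rule from the last cell down to the first, so that unpacking by
   division meets the cells in increasing order. The remainder is expressed through quotient,
   product and difference. *)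
pose R := Reg.
pose step1 := Seq (Assign 3 (Bin Sub (R 3) (Cst 1)))
  (Seq po (Assign 2 (Bin Add (Bin Mul (R 2) (R 1)) (R 4)))).
pose step2 := Seq (Store (R 3) (Bin Sub (R 2) (Bin Mul (Bin Div (R 2) (R 1)) (R 1))))
  (Seq (Assign 2 (Bin Div (R 2) (R 1))) (Assign 3 (Bin Add (R 3) (Cst 1)))).
pose body := Seq pl (Seq pb (Seq (Assign 2 (Cst 0)) (Seq (Assign 3 (R 0))
   (Seq (While (R 3) step1) (Seq (Assign 3 (Cst 0))
   (While (Bin Sub (R 0) (R 3)) step2)))))).
exists (Seq body (clear_regs (reg_bound body))); eexists => w w' V V2 hw hsw hsw' hww'.
set g : ctx 0 := nth 0 w.
set n := len g; set B := base g.
have hg : bounded g V.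
  split=> // a; rewrite /g /=; case: (ltnP a (size w)) => ha.
    by apply: (allP hw); apply: mem_nth.
  by rewrite nth_default.
have nV : n <= V ^ Kl by apply: bl.
have BV : B <= V ^ Kb by apply: bb.
have B0 : 0 < B by [].
have outB i : i < n -> out (g, i) < B.
  move=> hi; rewrite /B /base add1n ltnS (bigD1 (Ordinal hi)) //=.
  exact: leq_addr.
pose o := [seq out (g, i) | i <- iota 0 n].
have so : size o = n by rewrite size_map size_iota.
have ob : all (gtn B) o.
  by apply/allP => x /mapP[i]; rewrite mem_iota => /= hi ->; apply: outB.
have obd i : all (gtn B) (drop i o) by apply/allP => x /mem_drop; apply: (allP ob).
have no i : i < n -> nth 0 o i = out (g, i).
  by move=> hi; rewrite (nth_map 0) ?size_iota // nth_iota.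
(* The packed number is exponentially large, so [bitlen_exp_le] is of no use for it. All that occurs
   is at most [B ^ n.+2 <= 2 ^ Q], and its bit length is polynomial: here the logarithmic cost
   matters. *)
pose Q := B * n.+2.
have QB m : m <= n.+2 -> B ^ m <= 2 ^ Q.
  move=> hm; apply: (@leq_trans ((2 ^ B) ^ m)).
    case: m {hm} => // m; rewrite leq_exp2r //; exact/ltnW/ltn_expl.
  by rewrite -expnM leq_pexp2l // leq_mul2l hm orbT.
have bit v : v <= B ^ n.+2 -> bitlen v <= Q.+1.
  by move=> hv; apply: bitlen_exp; apply: leq_trans hv (QB _ (leqnn _)).
have bitn v : v <= n.+1 -> bitlen v <= Q.+1.
  move=> hv; apply: bitlen_exp; apply: leq_trans hv _.
  apply: leq_trans (ltnW (ltn_expl _ (ltnSn 1))) _; rewrite leq_pexp2l // /Q.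
  by apply: leq_trans (leqnSn _) _; rewrite leq_pmull.
have bitB : bitlen B <= Q.+1 by apply: bit; rewrite -{1}(expn1 B) leq_pexp2l.
have leB m x : x <= B ^ m -> m <= n.+2 -> x <= B ^ n.+2.
  by move=> h hm; apply: leq_trans h _; rewrite leq_pexp2l.
have bitu i : bitlen (undig B (drop i o)) <= Q.+1.
  apply: bit; apply: undig_leq => //; rewrite size_drop so; clear; lia.
have [s1 [r1 e1 a1]] := hpl g (init_state w) V V2 hg (conj erefl erefl).
have [//|s2 [r2 e2 a2]] := hpb g s1 V V2 hg _.
  by split=> //; case: a1.
have e1' : regs s2 0 = n by case: a2 => _ ->.
have m2 : memory s2 = g by case: a2 => ->; case: a1 => ->.
pose s3 := set_reg s2 2 0; pose s4 := set_reg s3 3 (regs s3 0).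
pose I i s := [/\ memory s = g, regs s 0 = n, regs s 1 = B, regs s 3 = n - i
   & regs s 2 = undig B (drop (n - i) o)].
have [|||s5 r5 I5] := @runs_while I n (R 3) step1 Q.+1
    (3 * Q.+1 + ((V ^ (Kl.+1)) ^ To + 5 * Q.+1)) _ _ s4.
- move=> i s hi [ms s0' s1' s3' s2']; split.
  + by rewrite /= s3' -lt0n subn_gt0.
  + by rewrite /= s3' addn0; apply: bitn; rewrite leqW // leq_subr.
  set i' := n - i.+1; have ei : n - i = i'.+1 by rewrite /i' subnSK.
  have hi' : i' < n by rewrite -ei leq_subr.
  pose u1 := set_reg s 3 i'.
  have hb : bounded (k := 1) (g, i') (V ^ Kl.+1).
    apply: bounded_push => //; apply: leq_trans (ltnW hi') _.
    exact: leq_expW nV.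
  have V2' : 2 <= V ^ Kl.+1 by rewrite (leq_trans V2) // leq_exp_gt0.
  have [//|u2 [ru2 eu2 [mu2 au2]]] := hpo (g, i') u1 _ V2' hb.
  have hu2 : undig B (drop i' o) = regs u2 2 * regs u2 1 + regs u2 4.
    rewrite (drop_nth 0) ?so //= -ei no // eu2 !au2 //= s1' s2' ei.
    by rewrite addnC mulnC.
  exists (set_reg u2 2 (undig B (drop i' o))).
    rewrite hu2; apply: runs_leq (runs_seq _ (runs_seq ru2
      (runs_assign _ (Bin Add (Bin Mul (R 2) (R 1)) (R 4)) _))); last first.
      have -> : u1 = set_reg s 3 (eval s (Bin Sub (R 3) (Cst 1))).
        by rewrite /= s3' ei subn1.
      exact: runs_assign.
    have b1 : bitlen 1 <= Q.+1 by apply: bitn.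
    have b2 : bitlen (n - i) <= Q.+1 by apply: bitn; rewrite leqW // leq_subr.
    have b3 : bitlen (n - i - 1) <= Q.+1.
      by apply: bitn; rewrite -subnDA leqW // leq_subr.
    rewrite leq_add //; first by rewrite /= s3' !addn0; clear -b1 b2 b3; lia.
    rewrite leq_add2l.
    change (bitlen (regs u2 2 * regs u2 1 + regs u2 4) +
      (bitlen (regs u2 2 * regs u2 1) + (bitlen (regs u2 2) + 0 + (bitlen (regs u2 1) + 0))
       + (bitlen (regs u2 4) + 0)) <= 5 * Q.+1).
    rewrite -hu2 (au2 1) // (au2 2) //= s1' s2' ei !addn0.
    have b4 : bitlen (undig B (drop i'.+1 o) * B) <= Q.+1.
      apply: bit; apply: leB (_ : _ <= B ^ n.+1) _ => //.
      by rewrite expnSr leq_mul // undig_leq // size_drop so leq_subr.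
    have b5 : bitlen (regs u2 4) <= Q.+1.
      by rewrite eu2; apply: leq_trans (leq_bitlen (ltnW (outB _ hi'))) bitB.
    have b6 := bitu i'; have b7 := bitu i'.+1.
    by clear -b4 b5 b6 b7 bitB; lia.
  by split; rewrite /= ?mu2 ?au2.
- move=> s [_ _ _ s3' _]; rewrite /= s3' subnn; split=> //.
- by rewrite /s4 /s3; split; rewrite //= ?subn0 ?drop_oversize ?so.
pose s6 := set_reg s5 3 0.
(* After [i] rounds the first [i] cells are rewritten and register 2 holds the digits still to come,
   so the input may be destroyed. *)
pose J i s := [/\ memory s = (fun a => if a < i then nth 0 w' a else nth 0 w a),
   regs s 0 = n, regs s 1 = B, regs s 3 = i & regs s 2 = undig B (drop i o)].
have [|||s7 r7 J7] := @runs_while J n (Bin Sub (R 0) (R 3)) step2 (3 * Q.+1)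
    ((Q.+1 + 7 * Q.+1) + (3 * Q.+1 + 3 * Q.+1)) _ _ s6.
- move=> i s hi [ms s0' s1' s3' s2']; split.
  + by rewrite /= s3' s0' -lt0n subn_gt0.
  + rewrite /= s3' s0' !addn0.
    have b1 : bitlen n <= Q.+1 by apply: bitn.
    have b2 : bitlen (n - i) <= Q.+1 by apply: bitn; rewrite leqW // leq_subr.
    have b3 : bitlen i <= Q.+1 by apply: bitn; rewrite leqW // ltnW.
    by clear -b1 b2 b3; lia.
  have eu : undig B (drop i o) = out (g, i) + B * undig B (drop i.+1 o).
    by rewrite (drop_nth 0) ?so //= no.
  have ediv : undig B (drop i o) %/ B = undig B (drop i.+1 o).
    by rewrite eu mulnC addnC divnMDl // divn_small ?addn0 ?outB.
  have emod : undig B (drop i o) - undig B (drop i.+1 o) * B = out (g, i).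
    by rewrite eu mulnC addnK.
  exists (set_reg (set_reg (set_mem s i (out (g, i))) 2 (undig B (drop i.+1 o))) 3 i.+1).
    have q1 := runs_store (R 3) (Bin Sub (R 2) (Bin Mul (Bin Div (R 2) (R 1)) (R 1))) s.
    rewrite [eval s (R 3)]s3' [eval _ _]/= s2' s1' ediv emod in q1.
    have q2 := runs_assign 2 (Bin Div (R 2) (R 1)) (set_mem s i (out (g, i))).
    rewrite [eval _ _]/= s2' s1' ediv in q2.
    have q3 := runs_assign 3 (Bin Add (R 3) (Cst 1))
      (set_reg (set_mem s i (out (g, i))) 2 (undig B (drop i.+1 o))).
    rewrite [eval _ _]/= s3' addn1 in q3.
    apply: runs_leq (runs_seq q1 (runs_seq q2 q3)).
    rewrite /= s1' s2' s3' ediv emod !addn0.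
    have b1 : bitlen 1 <= Q.+1 by apply: bitn.
    have b2 : bitlen i <= Q.+1 by apply: bitn; rewrite leqW // ltnW.
    have b3 : bitlen (i + 1) <= Q.+1 by apply: bitn; rewrite addn1 ltnW.
    have b4 : bitlen (undig B (drop i.+1 o) * B) <= Q.+1.
      apply: bit; apply: leB (_ : _ <= B ^ n.+1) _ => //.
      by rewrite expnSr leq_mul // undig_leq // size_drop so leq_subr.
    have b5 := leq_trans (leq_bitlen (ltnW (outB _ hi))) bitB.
    have b6 := bitu i; have b7 := bitu i.+1.
    by rewrite !leq_add //; clear -b1 b2 b3 b4 b5 b6 b7 bitB; lia.
  split=> //=.
  rewrite ms; apply/funext => a /=; rewrite ltnS [a <= i]leq_eqVlt.
  by case: eqP => [->|//] /=; exact: hww'.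
- move=> s [_ s0' _ s3' _]; rewrite /= s3' s0' subnn; split=> //.
  have b1 : bitlen n <= Q.+1 by apply: bitn.
  have b2 : bitlen 0 <= Q.+1 by apply: bitn.
  by rewrite !addn0; clear -b1 b2; lia.
- by case: I5; rewrite subnn => *; split.
case: J7 => m7 _ _ _ _.
have -> : init_state w' =
    State (fun x => if x < reg_bound body then 0 else regs s7 x) (memory s7).
  congr State.
    apply/funext => x; case: ltnP => // hx.
    (* The whole body is viewed as a single execution, here with no coins, to see that registers
       from [reg_bound body] on are still zero. *)
    have [t _ /(_ [::])] : exists2 t, True & forall r, exec body (init_state w) r s7 r t.
      have [t _ ht] := runs_seq r1 (runs_seq r2 (runs_seq (runs_assign 2 (Cst 0) _)
        (runs_seq (runs_assign 3 (R 0) _) (runs_seq r5 (runs_seq (runs_assign 3 (Cst 0) _) r7))))).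
      by exists t.
    by move=> /exec_reg_bound /(_ x hx) ->.
  (* From [len] on, neither word has cells: bounding [size w] as well guarantees that no remnant of
     the input survives. *)
  apply/funext => a; rewrite m7; case: ltnP => // ha.
  by rewrite !nth_default // (leq_trans _ ha).
apply: runs_leq (runs_seq (runs_seq r1 (runs_seq r2 (runs_seq (runs_assign 2 (Cst 0) _)
  (runs_seq (runs_assign 3 (R 0) _) (runs_seq r5 (runs_seq (runs_assign 3 (Cst 0) _) r7)))))
  ) (runs_clear_regs _ _)).
have h0' s : cost s (Cst 0) <= V ^ 1.
  by rewrite /= /bitlen trunc_log0 addn0 expn1 ltnW.
have hQ : Q.+1 <= V ^ (Kb + (Kl + 2).+1 + 1).+1.
  rewrite -addn1; apply: leq_exp_add => //; last exact: leq_exp_cst.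
  apply: leq_exp_mul => //; rewrite -addn2; apply: leq_exp_add => //.
  exact: leq_exp_cst.
have h1' : cost s3 (R 0) <= V ^ (Kb + (Kl + 2).+1 + 1).+1.
  by apply: leq_trans hQ; rewrite /= addn0 e1'; apply: bitn.
have c m : m <= V ^ m by apply: leq_exp_cst.
have hpo' : (V ^ Kl.+1) ^ To <= V ^ (Kl.+1 * To) by rewrite expnM.
have cb : (reg_bound body).+1 <= V ^ (reg_bound body).+1 by apply: c.
(* The exponent was left open by [eexists]; assembling the bounds along the structure of the running
   time determines it. *)
by repeat first [exact: (leqnn (V ^ Tl)) | exact: (leqnn (V ^ Tb)) | exact: h0'
  | exact: h1' | exact: hQ | exact: nV | exact: hpo' | exact: cb
  | exact: (c 3) | exact: (c 5) | exact: (c 7)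
  | match goal with |- is_true (_ + _ <= _) => eapply (leq_exp_add V2) end
  | eapply leq_exp_mul].
Qed.

(** The time bound also fixes the number of coins. Of the [t + T] coins [p] sees the first [T]; each
    bad sequence of length [T] has [2 ^ t] extensions, so the error probability does not grow. *)
Lemma decides_within_seq q p w w' b t T :
  runs q (init_state w) (init_state w') t -> decides_within p w' b T ->
  decides_within (Seq q p) w b (t + T).
Proof.
move=> [t0 ht0 hq] [hh ho].
have exec_pref (r : (t + T).-tuple bool) s' r' u :
    exec p (init_state w') (take T r) s' r' u ->
    exec (Seq q p) (init_state w) r s' (r' ++ drop T r) (t0 + u).
  move=> /(exec_cat_coins (drop T r)); rewrite cat_take_drop => h.
  exact: exec_seq (hq r) h.
have szT (r : (t + T).-tuple bool) : size (take T r) == T.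
  by rewrite size_takel // size_tuple leq_addl.
have szt (r : (t + T).-tuple bool) : size (drop T r) == t.
  by rewrite size_drop size_tuple addnK.
pose pref r := Tuple (szT r); pose suff r := Tuple (szt r).
split.
  move=> r; have [s' [r' [u [h hu]]]] := hh (pref r).
  by exists s', (r' ++ drop T r), (t0 + u); split; [exact: exec_pref h|exact: leq_add].
set bad := [set r : T.-tuple bool | _] in ho.
set bad' := [set r : (t + T).-tuple bool | _].
have inj : injective (fun r => (pref r, suff r)).
  move=> r1 r2 [e1 e2]; apply/val_inj; rewrite /= -(cat_take_drop T r1) e1 e2.
  by rewrite cat_take_drop.
have : #|bad'| <= #|finset.setX bad [set: t.-tuple bool]|.
  rewrite -(card_imset _ inj); apply/subset_leq_card/fintype.subsetP => _ /imsetP[r hr ->].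
  rewrite !inE /= andbT; move: hr; rewrite inE; apply: contra => /asboolP.
  move=> [s' [r' [u [h hu hb]]]]; apply/asboolP.
  by exists s', (r' ++ drop T r), (t0 + u); split; [exact: exec_pref h|exact: leq_add|].
rewrite cardsX cardsT card_tuple card_bool => h.
apply: (@leq_trans (3 * (#|bad| * 2 ^ t))); first by rewrite leq_mul2l h.
by rewrite mulnA expnD mulnC leq_mul2l ho orbT.
Qed.

Lemma computed_in_time_reduction (L1 L2 : problem) (size_of : nat -> nat) D
    (len : ctx 0 -> nat) (out : ctx 1 -> nat) :
    cmp 0 len -> cmp 1 out ->
    (forall n w b, L1 n w b ->
       all (fun v => v <= n.+2 ^ D) w /\
       exists w', [/\ L2 (size_of n) w' b, size w <= len (nth 0 w),
         size w' <= len (nth 0 w) &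
         forall i, i < len (nth 0 w) -> out (nth 0 w, i) = nth 0 w' i]) ->
  exists K, forall T, computed_in_time L2 T ->
    computed_in_time L1 (fun n => n.+2 ^ K + T (size_of n)).
Proof.
move=> hlen hout red; have [q [K hq]] := runs_rewrite_memory hlen hout.
(* The machine part is applied with [V = n.+2 ^ D.+1], which bounds the input cells and is at least
   2 even if [D = 0]. *)
exists (D.+1 * K) => T [p hp]; exists (Seq q p) => n w b /red [hw [w' [h2 h3 h4 h5]]].
apply: decides_within_seq (hp _ _ _ h2); rewrite expnM; apply: hq => //.
  exact: leq_trans (leq_exp_gt0 D (isT : 2 <= n.+2)).
by apply: sub_all hw => v hv; apply: leq_trans hv _; rewrite leq_pexp2l.
Qed.

(** * Exponential time with polynomial overhead *)

Lemma bigO_expP (R : realType) (T : nat -> nat) (eps : R) :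
  ((fun n => (T n)%:R%R : R^o) =O_\oo (fun n => (2 `^ (eps * n%:R))%R : R^o))%classic <->
  exists C N, (0 < C)%R /\
    forall n, N <= n -> ((T n)%:R <= C * 2 `^ (eps * n%:R) :> R)%R.
Proof.
split.
  move=> /eqO_exP [C C0 [N _ hN]]; exists C, N; split=> // n hn.
  by have /= := hN n hn; rewrite /= !ger0_norm ?ler0n ?powR_ge0.
move=> [C [N [C0 hN]]]; apply/eqO_exP; exists C => //.
by exists N => // n /= hn; rewrite !ger0_norm ?ler0n ?powR_ge0 // hN.
Qed.

Lemma computed_in_exp_timeW (R : realType) L (eps eps' : R) :
  (eps <= eps')%R -> computed_in_exp_time L eps -> computed_in_exp_time L eps'.
Proof.
move=> h [T [/bigO_expP[C [N [C0 hT]]] hL]]; exists T; split=> //.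
apply/bigO_expP; exists C, N; split=> // n hn; apply: le_trans (hT n hn) _.
by rewrite ler_pM2l // ler_powR ?ler1n // ler_wpM2r.
Qed.

Lemma poly_le_exp (R : realType) K (eps : R) : (0 < eps)%R ->
  exists2 C, (0 <= C)%R & forall n, ((n.+2 ^ K)%:R <= C * 2 `^ (eps * n%:R) :> R)%R.
Proof.
move=> eps0; set a := (eps * ln 2)%R.
have a0 : (0 < a)%R by rewrite mulr_gt0 // ln_gt0 // ltr1n.
(* Obtained by solving [x ^+ K.+1 / K.+1! <= expR x] at [x = a * n.+2] for the power of [n.+2]; the
   shift by 2 contributes [expR (2 * a)]. *)
exists (K.+1`!%:R * expR (2 * a) / a ^+ K.+1)%R.
  by rewrite mulr_ge0 ?mulr_ge0 ?expR_ge0 ?invr_ge0 ?exprn_ge0 // ltW.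
move=> n; have x0 : (0 <= a * n.+2%:R)%R by rewrite mulr_ge0 // ltW.
have e : (expR (a * n.+2%:R) = expR (2 * a) * 2 `^ (eps * n%:R) :> R)%R.
  rewrite /powR pnatr_eq0 /= -expRD; congr expR.
  by rewrite -addn2 natrD mulrDr addrC (mulrC a 2%R) /a mulrAC.
have := le_trans (_ : _ <= _)%R (expR_ge1Dxn K x0).
move=> /(_ ((a * n.+2%:R) ^+ K.+1 / K.+1`!%:R)%R); rewrite lerDr ler01 => /(_ isT).
rewrite e exprMn ler_pdivrMr ?ltr0n ?fact_gt0 // => h.
apply: le_trans (_ : (n.+2%:R ^+ K.+1 <= _)%R).
  by rewrite natrX ler_eXn2l // ?ltr1n.
rewrite mulrAC ler_pdivlMr ?exprn_gt0 // mulrC (le_trans h) //.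
by rewrite mulrC mulrA.
Qed.

(** A positive [eps'] absorbs the polynomial overhead, and the additive [c], meant for a partly
    filled last block, becomes the factor [2 ^ c]. Since [n <= size_of n], a bound valid for large
    sizes applies to large [n]. *)
Lemma computed_in_exp_time_reduction (R : realType) (L1 L2 : problem)
    (size_of : nat -> nat) K (eps eps' c : R) :
    (0 < eps')%R -> (forall n, n <= size_of n) ->
    (forall n, (eps * (size_of n)%:R <= eps' * n%:R + c)%R) ->
    (forall T, computed_in_time L2 T ->
       computed_in_time L1 (fun n => n.+2 ^ K + T (size_of n))) ->
  computed_in_exp_time L2 eps -> computed_in_exp_time L1 eps'.
Proof.
move=> e0 hs hc red [T [/bigO_expP[C [N [C0 hT]]] /red hL]].
exists (fun n => n.+2 ^ K + T (size_of n)); split=> //.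
have [C' C'0 hC'] := poly_le_exp K e0.
apply/bigO_expP; exists (C' + C * 2 `^ c)%R, N; split.
  by rewrite ltr_wpDl // mulr_gt0 // powR_gt0.
move=> n hn; rewrite natrD mulrDl lerD //.
apply: le_trans (hT _ (leq_trans hn (hs n))) _.
rewrite -mulrA -powRD; last by rewrite pnatr_eq0 implybT.
by rewrite ler_pM2l // ler_powR ?ler1n // addrC.
Qed.

(** * Parity of hitting sets and set covers *)

Lemma odd_sum_card (T : finType) (f : T -> nat) :
  odd (\sum_x f x) = odd #|[set x | odd (f x)]|.
Proof.
have oddE : {morph odd : m n / m + n >-> m (+) n} := oddD.
rewrite (big_morph odd oddE (erefl : odd 0 = false)) -sum1_card.
rewrite (big_morph odd oddE (erefl : odd 0 = false)) [RHS]big_mkcond /=.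
by apply: eq_bigr => x _; rewrite inE; case: odd.
Qed.

(* Both counts have the parity of the number of pairs [(H, C)] such that no
   member of [C] meets [H]. *)
Lemma parity_hitting_set_cover n (F : set_family n) :
  odd #|[set H | hitting_set F H]| = odd #|[set C | set_cover F C]|.
Proof.
pose r (H : {set 'I_n}) (C : set_family n) :=
  (C \subset F) && [forall S in C, H :&: S == finset.set0].
(* For fixed [H], as for fixed [C] below, the partners form a powerset, whose cardinality is odd
   only if the underlying set is empty: [H] misses no member of [F], respectively [C] leaves no
   element uncovered. *)
have rH H : [set C | r H C] = powerset [set S in F | H :&: S == finset.set0].
  apply/setP => C; rewrite inE powersetE; apply/andP/fintype.subsetP.
    move=> [/fintype.subsetP CF /forall_inP hC] S SC; rewrite inE.
    by rewrite CF //= hC.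
  move=> h; split; first by apply/fintype.subsetP => S /h; rewrite inE => /andP[].
  by apply/forall_inP => S /h; rewrite inE => /andP[].
have rC (C : set_family n) : C \subset F -> [set H | r H C] = powerset (~: finset.cover C).
  move=> CF; apply/setP => H; rewrite inE powersetE /r CF /=.
  rewrite -finset.disjoints_subset.
  apply/forall_inP/idP => [h|].
    apply/finset.bigcup_disjointP => S SC.
    by rewrite -finset.setI_eq0 h.
  move=> /finset.bigcup_disjointP h S SC.
  by rewrite finset.setI_eq0 h.
have -> : [set H | hitting_set F H] = [set H | odd #|[set C | r H C]|].
  apply/setP => H; rewrite !inE rH card_powerset oddX orbF cards_eq0.
  apply/forall_inP/eqP => [h|h S SF].
    apply/setP => S; rewrite !inE; apply/negP => /andP[/h hS]; exact/negP.
  by apply/negP => hS; have := finset.in_set0 S; rewrite -h inE SF hS.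
have -> : [set C | set_cover F C] = [set C | odd #|[set H | r H C]|].
  apply/setP => C; rewrite !inE /set_cover.
  case: (boolP (C \subset F)) => CF /=.
    by rewrite rC // card_powerset oddX orbF cards_eq0 -finset.setCT (inj_eq (@finset.setC_inj _)).
  rewrite [X in #|pred_of_set X|](_ : _ = finset.set0) ?cards0 //.
  by apply/setP => H; rewrite !inE /r (negbTE CF).
rewrite -!odd_sum_card; congr odd.
under eq_bigr => H _ do rewrite -sum1_card big_mkcond /=.
rewrite exchange_big /=; apply: eq_bigr => C _.
rewrite -sum1_card [RHS]big_mkcond /=.
by apply: eq_bigr => H _; rewrite !inE.
Qed.

Lemma parity_set_coverE k : parity_set_cover k = parity_hitting_set k.
Proof.
apply/funext => n; apply/funext => w; apply/funext => b.
apply/propext; split=> -[F [h1 h2 h3]]; exists F; split=> //.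
  by rewrite parity_hitting_set_cover.
by rewrite -parity_hitting_set_cover.
Qed.

(** * Reading and writing encodings *)

Lemma lists_familyP (T : finType) (F : {set {set T}}) (L : seq (seq T)) :
  reflect [/\ all uniq L, uniq [seq [set x in l] | l <- L]
            & F =i [seq [set x in l] | l <- L]] (lists_family F L).
Proof.
apply: (iffP andP) => [[h1 h2]|[h1 h2 h3]]; split=> //.
- by rewrite (perm_uniq h2) enum_uniq.
- by move=> S; rewrite (perm_mem h2) mem_enum.
- by apply: uniq_perm => //; [exact: enum_uniq|move=> S; rewrite mem_enum h3].
Qed.

Definition rows (X : seq (seq nat)) := flatten [seq size l :: l | l <- X].

Fixpoint row_start (X : seq (seq nat)) j {struct j} :=
  if j is j'.+1 then
    if X is l :: X' then (size l).+1 + row_start X' j' else 0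
  else 0.

Lemma row_start_size X : row_start X (size X) = size (rows X).
Proof. by elim: X => //= l X ->; rewrite size_cat. Qed.

Lemma nth_rows_size X j : j < size X ->
  nth 0 (rows X) (row_start X j) = size (nth [::] X j).
Proof.
elim: X j => // l X IH [|j] //= hj.
by rewrite nth_cat ltnNge leq_addr addKn IH.
Qed.

Lemma nth_rows X j t : j < size X -> t < size (nth [::] X j) ->
  nth 0 (rows X) (row_start X j + t.+1) = nth 0 (nth [::] X j) t.
Proof.
elim: X j => // l X IH [|j] //= hj ht; first by rewrite nth_cat ht.
by rewrite nth_cat -addnA ltnNge leq_addr addKn IH.
Qed.

Lemma row_startS X j : j < size X ->
  row_start X j.+1 = row_start X j + (size (nth [::] X j)).+1.
Proof.
elim: X j => // l X IH [|j] hj; first by rewrite /= addnC.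
by rewrite -[LHS]/((size l).+1 + row_start X j.+1) IH // addnA.
Qed.

(* Follows the chain of row headers. *)
Definition start (M : nat -> nat) j := iteri j (fun _ y => y + M y + 1) 2.

Lemma cmp_start k (f : ctx k -> nat) :
  cmp k f -> cmp k (fun g => start (ctx_mem g) (f g)).
Proof.
move=> hf; apply: (@cmp_iteri _ f (fun=> 2) (fun g _ y => y + ctx_mem g y + 1)) => //.
- exact: cmp_cst.
- apply: cmpD; last exact: cmp_cst.
  by apply: cmpD (cmp_var _) _; exact: (@cmp_mem k.+2 (fun p => p.2) (cmp_var _)).
have [[K hK] _] := hf; exists (2 + (K + (1 + 1).+1)).+1 => g V V2 hg i hi.
apply: (@leq_trans (2 + i * (V + 1))).
  elim: i {hi} => //= i IH; rewrite mulSn.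
  by have [/(_ (iteri i (fun _ y => y + ctx_mem g y + 1) 2)) h _] := hg; clear -IH h; lia.
apply: leq_exp_add; [exact: V2|exact: leq_exp_cst|].
apply: leq_exp_mul; first exact: leq_trans hi (hK _ _ V2 hg).
by apply: leq_exp_add => //; exact: (@leq_exp_cst V 1).
Qed.

Lemma start_encode n X j : j <= size X ->
  start (nth 0 (encode_lists n X)) j = (row_start X j).+2.
Proof.
elim: j => [|j IH] hj; first by case: X {hj}.
set M := nth 0 _; have -> : start M j.+1 = start M j + M (start M j) + 1 by [].
rewrite IH ?(ltnW hj) // row_startS // /M [nth _ _ _]/= nth_rows_size //.
by rewrite addn1 !addSn addnS.
Qed.

(** Intended for the test whether some clause in the input has all its literals falsified. *)
Lemma cmpb_pred_row k (h : ctx k -> nat -> bool) : cmpb k.+1 (fun p => h p.1 p.2) ->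
  cmpb k (fun g => [exists j : 'I_(ctx_mem g 1),
    [forall t : 'I_(ctx_mem g (start (ctx_mem g) j)),
       h g (ctx_mem g (start (ctx_mem g) j + t.+1))]]).
Proof.
move=> hh.
apply: (@cmpb_exists _ (fun g => ctx_mem g 1) (fun g j =>
   [forall t : 'I_(ctx_mem g (start (ctx_mem g) j)),
       h g (ctx_mem g (start (ctx_mem g) j + t.+1))])).
  exact: cmp_mem (cmp_cst _ _).
have hs : cmp k.+1 (fun p => start (ctx_mem p) p.2) by apply/cmp_start/cmp_var.
apply: (@cmpb_forall k.+1 (fun p => ctx_mem p (start (ctx_mem p) p.2))
  (fun p t => h p.1 (ctx_mem p (start (ctx_mem p) p.2 + t.+1)))).
  exact: cmp_mem.
have ha : cmp k.+2 (fun q => @ctx_mem k.+1 q.1 (start (@ctx_mem k.+1 q.1) q.1.2 + q.2.+1)).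
  exact: (@cmp_mem k.+2 _ (cmpD (cmp_weaken hs) (cmpS (cmp_var k.+1)))).
exact: (@cmp_let k.+2 _ _ ha (cmp_weaken_under (cmp_weaken_under hh))).
Qed.

Lemma exists_row n X (h : pred nat) :
  let M := nth 0 (encode_lists n X) in
  [exists j : 'I_(M 1), [forall t : 'I_(M (start M j)), h (M (start M j + t.+1))]]
  = has (all h) X.
Proof.
move=> M; have rowM j : j < size X ->
    [forall t : 'I_(M (start M j)), h (M (start M j + t.+1))] = all h (nth [::] X j).
  move=> hj; rewrite start_encode ?(ltnW hj) //.
  have -> : M (row_start X j).+2 = size (nth [::] X j) by exact: nth_rows_size.
  apply/forallP/(all_nthP 0) => [H t ht|H t].
    by have := H (Ordinal ht); rewrite /M /= nth_rows.
  by rewrite /M /= nth_rows //; apply: H.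
apply/existsP/(has_nthP [::]) => [[j]|[j hj H]].
  by rewrite rowM => [h1|]; [exists j|case: j].
by exists (Ordinal hj); rewrite /= rowM.
Qed.

Lemma size_encode_lists n X :
  size (encode_lists n X) = start (nth 0 (encode_lists n X)) (size X).
Proof. by rewrite start_encode // row_start_size. Qed.

(** A set of at most [k] elements is the range of a [k]-tuple padded with [None]. *)
Lemma card_bounded_family (T : finType) k (F : {set {set T}}) :
  bounded_family k F -> #|F| <= #|T|.+1 ^ k.
Proof.
move=> /forall_inP hF; rewrite -card_option -card_tuple.
pose f (t : k.-tuple (option T)) := [set x | Some x \in t].
apply: leq_trans (leq_imset_card f predT).
apply/subset_leq_card/fintype.subsetP => S /hF hS; apply/imsetP.
have sz : size (take k ([seq Some x | x <- enum S] ++ nseq k None)) == k.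
  by rewrite size_takel // size_cat size_nseq leq_addl.
exists (Tuple sz) => //; apply/setP => x; rewrite inE memtE /= take_cat size_map -cardE.
have notin m : Some x \in nseq m (None : option T) = false by rewrite mem_nseq andbF.
case: ltnP => hk; first by move: hS; rewrite leqNgt hk.
rewrite mem_cat mem_map; last by move=> ? ? [].
rewrite mem_enum; case: (x \in S) => //=; apply/esym/negbTE/negP => /mem_take.
by rewrite notin.
Qed.

Lemma encodes_bounded (T : finType) (code : T -> nat) k F n w V :
    bounded_family k F -> encodes n code F w ->
    (forall x, code x <= V) -> n <= V -> k <= V -> #|T|.+1 ^ k <= V ->
  all (fun v => v <= V) w.
Proof.
move=> hF [L /lists_familyP[h1 h2 h3] ->] hc hn hk hT.
have memF l : l \in L -> [set x in l] \in F by move=> h; rewrite h3 map_f.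
have szF : size L <= V.
  apply: leq_trans hT; apply: leq_trans (card_bounded_family hF).
  rewrite -(size_map (fun l => [set x in l])) -(card_uniqP h2).
  by apply/subset_leq_card/fintype.subsetP => S; rewrite h3.
rewrite /encode_lists /= hn size_map szF /=; apply/allP => v /flattenP[s].
move=> /mapP[r /mapP[l lL ->] ->]; rewrite inE => /orP[/eqP ->|/mapP[x _ -> //]].
rewrite size_map; apply: leq_trans hk; have /card_uniqP <- := allP h1 _ lL.
by have := forall_inP hF _ (memF _ lL); rewrite cardsE.
Qed.

Lemma nth_rows_map (f : nat -> nat) X i : i < size (rows X) ->
  nth 0 (rows [seq map f l | l <- X]) i =
  if has (fun j => row_start X j == i) (iota 0 (size X)) then nth 0 (rows X) i
  else f (nth 0 (rows X) i).
Proof.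
elim: X i => // l X IH [|i] hi; first by rewrite /= size_map.
rewrite [LHS]/= /rows /= -/(rows X) nth_cat size_map.
have -> : has (fun j => row_start (l :: X) j == i.+1) (iota 1 (size X)) =
  has (fun j => (size l).+1 + row_start X j == i.+1) (iota 0 (size X)).
  by rewrite (iotaDl 1 0) has_map.
rewrite nth_cat; case: ltnP => hl.
  rewrite (nth_map 0) //; case: hasP => // -[j _ /eqP]; rewrite addSn => -[e].
  by move: hl; rewrite -e ltnNge leq_addr.
rewrite IH; last by move: hi; rewrite /rows /= size_cat ltnS -/(rows X); clear -hl; lia.
congr (if _ then _ else _); apply: eq_has => j /=.
by rewrite addSn eqSS -{2}(subnKC hl) eqn_add2l.
Qed.

Lemma existsb_iota N (P : pred nat) : [exists j : 'I_N, P j] = has P (iota 0 N).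
Proof.
apply/existsP/hasP => [[j hj]|[j]]; first by exists (val j) => //; rewrite mem_iota /=.
by rewrite mem_iota /= => hj Pj; exists (Ordinal hj).
Qed.

(** * Hitting sets as models of monotone formulas *)

Definition cnf_of_sets n (F : set_family n) : cnf n :=
  [set [set (i, true) | i in S : {set 'I_n}] | S in F].

Lemma pair_true_inj n : injective (fun i : 'I_n => (i, true)).
Proof. by move=> i j []. Qed.

Lemma parity_cnf_of_sets n (F : set_family n) :
  #|[set a | satisfies a (cnf_of_sets F)]| = #|[set H | hitting_set F H]|.
Proof.
pose f (H : {set 'I_n}) := [ffun i => i \in H].
have f_inj : injective f.
  by move=> H1 H2 /ffunP e; apply/setP => i; have := e i; rewrite !ffunE.
rewrite -(card_imset _ f_inj); apply: eq_card => a; rewrite inE.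
have satE H : satisfies (f H) (cnf_of_sets F) = hitting_set F H.
  apply/forall_inP/forall_inP => [h S SF|h _ /imsetP[S SF ->]].
    have /existsP[l /andP[/imsetP[i iS ->]]] := h _ (imset_f _ SF).
    rewrite ffunE eqb_id /= => iH.
    by apply/finset.set0Pn; exists i; rewrite inE iH.
  have /finset.set0Pn[i] := h _ SF; rewrite inE => /andP[iH iS].
  by apply/existsP; exists (i, true); rewrite imset_f // ffunE eqb_id.
apply/idP/imsetP => [ha|[H]]; last by rewrite inE -satE => ? ->.
have e : a = f [set i | a i] by apply/ffunP => i; rewrite ffunE inE.
by exists [set i | a i] => //; rewrite inE -satE -e.
Qed.

Lemma hitting_set_to_cnf n k w b : parity_hitting_set k n w b ->
  exists X, w = encode_lists n X /\
    parity_cnf_sat k n (encode_lists n [seq [seq 2 * v | v <- l] | l <- X]) b.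
Proof.
move=> [F [h1 [L /lists_familyP[L1 L2 L3] ->] ->]].
eexists; split; first by [].
have im_inj := finset.imset_inj (@pair_true_inj n).
exists (cnf_of_sets F); split.
- apply/forall_inP => _ /imsetP[S SF ->].
  by rewrite card_imset; [exact: (forall_inP h1)|exact: pair_true_inj].
- have setE (l : seq 'I_n) :
      [set x in [seq (i, true) | i <- l]] = [set (i, true) | i in [set x in l]].
    apply/setP => y; rewrite inE; apply/mapP/imsetP => -[i hi ->]; exists i => //.
      by rewrite inE.
    by rewrite inE in hi.
  have mapE : [seq [set x in l] | l <- [seq [seq (i, true) | i <- l] | l <- L]] =
      [seq [set (i, true) | i in A] | A : {set 'I_n} <- [seq [set x in l] | l <- L]].
    by rewrite -!map_comp; apply: eq_map => l /=; rewrite setE.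
  exists [seq [seq (i, true) | i <- l] | l <- L].
    apply/lists_familyP; split.
    + by rewrite all_map; apply: sub_all L1 => l hl /=; rewrite (map_inj_uniq (@pair_true_inj n)).
    + by rewrite mapE (map_inj_uniq im_inj).
    + move=> C; rewrite mapE; apply/imsetP/mapP => -[S hS ->]; exists S => //.
        by rewrite -L3.
      by rewrite L3.
  congr encode_lists; rewrite -!map_comp; apply: eq_map => l /=.
  by rewrite -!map_comp; apply: eq_map => i; rewrite /= /literal_code /= addn0.
- by rewrite parity_cnf_of_sets.
Qed.

Lemma bound_exp n k : [/\ k <= n.+2 ^ k, (2 * n).+1 <= n.+2 ^ 2 & (2 * n).+1 ^ k <= n.+2 ^ (2 * k)].
Proof.
have h : (2 * n).+1 <= n.+2 ^ 2 by rewrite -mulnn; clear; nia.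
split=> //; first by apply: leq_exp_cst.
by rewrite expnM; case: k => // k; rewrite leq_exp2r.
Qed.

Lemma hitting_set_time_reduction k : exists K, forall T,
  computed_in_time (parity_cnf_sat k) T ->
  computed_in_time (parity_hitting_set k) (fun n => n.+2 ^ K + T n).
Proof.
pose len (g : ctx 0) := start g (g 1).
(* The positive literal of [i] has code [2 * i], so every cell is doubled except the two leading
   ones and the row headers. *)
pose out (g : ctx 1) := if g.2 < 2 then g.1 g.2
  else if [exists j : 'I_(g.1 1), start g.1 j == g.2] then g.1 g.2 else 2 * g.1 g.2.
have hlen : cmp 0 len by apply: (@cmp_start 0); exact: (@cmp_mem 0 _ (cmp_cst _ _)).
have hmem : cmp 1 (fun g => g.1 g.2) by exact: (@cmp_mem 1 _ (cmp_var _)).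
have hout : cmp 1 out.
  apply: cmp_if; [by apply: cmpb_ltn (cmp_var _) (cmp_cst _ _)|exact: hmem|].
  apply: cmp_if; [|exact: hmem|exact: cmpM (cmp_cst _ _) hmem].
  apply: (@cmpb_exists 1 (fun g => g.1 1) (fun g j => start g.1 j == g.2)).
    exact: (@cmp_mem 1 _ (cmp_cst _ _)).
  apply: cmpb_eqn; first exact: (@cmp_start 2 _ (cmp_var _)).
  exact: (cmp_weaken (cmp_var _)).
(* The exponent adds up the three in [bound_exp], so that one power bounds every kind of cell. *)
apply: (@computed_in_time_reduction _ _ id (2 * k + 2 + k) _ _ hlen hout) => n w b h.
have [b1 b2 b3] := bound_exp n k.
have up m V : V <= n.+2 ^ m -> m <= 2 * k + 2 + k -> V <= n.+2 ^ (2 * k + 2 + k).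
  by move=> hV hm; apply: leq_trans hV _; rewrite leq_pexp2l.
split.
  case: h => F [h1 h2 _]; apply: encodes_bounded h1 h2 _ _ _ _.
  - by move=> i; apply: (up 1); [rewrite expn1; case: i => i /=; clear; lia|clear; lia].
  - by apply: (up 1); [rewrite expn1|]; clear; lia.
  - by apply: up b1 _; clear; lia.
  - rewrite card_ord; apply: (up (2 * k)); last by clear; lia.
    apply: leq_trans b3; case: k {b1 up} => // k; rewrite leq_exp2r //; clear; lia.
have [X [-> hX]] := hitting_set_to_cnf h.
set w' := encode_lists n [seq _ | _ <- X] in hX.
have szr : size (rows [seq [seq 2 * v | v <- l] | l <- X]) = size (rows X).
  rewrite /rows !size_flatten /shape -!map_comp; congr sumn; apply: eq_map => l /=.
  by rewrite size_map.
have lenE : len (nth 0 (encode_lists n X)) = (size (rows X)).+2.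
  by rewrite /len -[nth _ _ 1]/(size X) start_encode // row_start_size.
exists w'; split=> //.
- by rewrite lenE.
- by rewrite lenE /= -/(rows _) szr.
rewrite lenE => -[|[|i]] hi; rewrite /out //=; first by rewrite size_map.
rewrite -!/(rows _) nth_rows_map //.
rewrite (existsb_iota _ (fun j => start (nth 0 (encode_lists n X)) j == i.+2)).
congr (if _ then _ else _); apply: eq_in_has => j; rewrite mem_iota /= => hj.
by rewrite start_encode // ltnW.
Qed.

(** * The block gadget *)

Definition toggle (T : finType) (x : T) (H : {set T}) : {set T} :=
  if x \in H then H :\ x else x |: H.

Lemma in_toggle (T : finType) (x y : T) H :
  (y \in toggle x H) = if y == x then x \notin H else y \in H.
Proof.
by rewrite /toggle; case: ifP => hx; rewrite !inE; case: eqP => [->|] //=.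
Qed.

Lemma toggleK (T : finType) (x : T) : involutive (toggle x).
Proof.
move=> H; apply/setP => y; rewrite !in_toggle eqxx negbK.
by case: eqP => [->|].
Qed.

(** A set and its image have the same distinguished point, so toggling is an involution on [A]; it
    exchanges the sets containing their point with the others, and these two halves are
    equinumerous. *)
Lemma even_card_toggle (T : finType) (A : {set {set T}}) (pt : {set T} -> T) :
    {in A, forall H, toggle (pt H) H \in A /\ pt (toggle (pt H) H) = pt H} ->
  ~~ odd #|A|.
Proof.
move=> hA; pose t H := toggle (pt H) H.
have tK : {in A, involutive t} by move=> H /hA [_ e]; rewrite /t e toggleK.
rewrite -(cardsID [set H | pt H \in H] A).
have -> : A :\: [set H | pt H \in H] = t @: (A :&: [set H | pt H \in H]).
  apply/setP => H; rewrite !inE; apply/andP/imsetP => [[h1 h2]|[G]].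
    exists (t H); last by rewrite tK.
    by have [h3 e] := hA _ h2; rewrite !inE h3 /t e in_toggle eqxx.
  rewrite !inE => /andP[h1 h2] ->; have [h3 e] := hA _ h1.
  by rewrite h3 /t e in_toggle eqxx h2.
rewrite card_in_imset ?addnn ?odd_double // => G H; rewrite !inE => /andP[hG _] /andP[hH _] e.
by rewrite -(tK G hG) e tK.
Qed.

(* A block of [beta] variables is represented by the subsets of a set of size
   [q].  Each assignment has one code; among the other subsets, the junk ones
   are paired off by [toggle gpt] and the remaining ones are to be excluded. *)
Record gadget (beta q : nat) := Gadget {
  gcode : {ffun 'I_beta -> bool} -> {set 'I_q};
  junk : pred {set 'I_q};
  gpt : 'I_q;
  gcode_inj : injective gcode;
  junk_super : forall X Y : {set 'I_q}, X \subset Y -> junk X -> junk Y;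
  junk_code : forall a (Y : {set 'I_q}), gcode a \proper Y -> junk Y;
  code_not_junk : forall a, ~~ junk (gcode a);
  junk_toggle : forall X, junk (toggle gpt X) = junk X }.

Definition excluded beta q (G : gadget beta q) (X : {set 'I_q}) :=
  ~~ junk G X && ~~ [exists a, X == gcode G a].

Lemma code_not_excluded beta q (G : gadget beta q) a : ~~ excluded G (gcode G a).
Proof. by rewrite negb_and !negbK; apply/orP; right; apply/existsP; exists a. Qed.

(** Were [X] junk or a code, then [Y] would be junk by [junk_super] or [junk_code]. Exclusion is
    therefore inherited by subsets, as hitting constraints require. *)
Lemma excluded_proper beta q (G : gadget beta q) (X Y : {set 'I_q}) :
  X \proper Y -> ~~ junk G Y -> excluded G X.
Proof.
move=> XY jY; apply/andP; split.
  by apply: contra jY; apply: junk_super; apply: proper_sub.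
by apply/existsP => -[a /eqP e]; rewrite e in XY; rewrite (junk_code XY) in jY.
Qed.

Lemma excluded_sub beta q (G : gadget beta q) (X Y : {set 'I_q}) :
  X \subset Y -> excluded G Y -> excluded G X.
Proof.
rewrite finset.subEproper => /orP[/eqP -> //|XY] /andP[hY _].
exact: excluded_proper XY hY.
Qed.

(** A predicate on numbers covers both a set [H] and the complement of a list of digits that the
    machine computes. *)
Definition block q (h : pred nat) i : {set 'I_q} := [set e : 'I_q | h (i * q + e)].
Arguments block : clear implicits.

Lemma block_sub q (h h' : pred nat) i : {subset h' <= h} -> block q h' i \subset block q h i.
Proof. by move=> hh; apply/fintype.subsetP => e; rewrite !inE; apply: hh. Qed.

(* [c] is the code of a literal, whose variable is number [c./2]. *)
Definition lit_block beta c := c %/ (2 * beta).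

(** Odd codes are negative literals, so the literal is false under [a] when [a p] equals [odd c].
    Only codes refute anything; junk and excluded sets do not. *)
Definition refuted beta q (G : gadget beta q) (X : {set 'I_q}) c :=
  [exists a, (X == gcode G a) &&
     [exists p : 'I_beta, (p == (c %% (2 * beta))./2 :> nat) && (a p == odd c)]].

(** Refutation alone does not pass to subsets, but everything strictly below a code is excluded. *)
Lemma refuted_sub beta q (G : gadget beta q) (X Y : {set 'I_q}) c :
  X \subset Y -> refuted G Y c -> refuted G X c || excluded G X.
Proof.
rewrite finset.subEproper => /orP[/eqP -> -> //|XY] /existsP[a /andP[/eqP e _]].
by rewrite e in XY; rewrite (excluded_proper XY) ?orbT // code_not_junk.
Qed.

Definition falsified beta q (G : gadget beta q) h c :=
  refuted G (block q h (lit_block beta c)) c.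

(** There is always at least one block; if [beta] divides [n], the last one is pure padding. *)
Definition blocks beta n := (n %/ beta).+1.

(* The variables from [n] on, which only fill up the last block, have to be false. *)
Definition inadmissible beta q (G : gadget beta q) n (cl : seq (seq nat)) h :=
  [|| [exists i : 'I_(blocks beta n), excluded G (block q h i)],
      [exists v : 'I_(blocks beta n * beta), (n <= v) && falsified G h (2 * v + 1)]
    | has (all (falsified G h)) cl].

Lemma lit_block_padding beta n v :
  v < blocks beta n * beta -> lit_block beta (2 * v + 1) < blocks beta n.
Proof.
move=> hv; rewrite /lit_block ltn_divLR; last by case: beta hv => [|?]; rewrite ?muln0 // muln_gt0.
move: hv; set m := _ * beta => hv; rewrite mulnCA -/m; clear -hv; lia.
Qed.

Definition in_blocks beta n (cl : seq (seq nat)) :=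
  all (all (fun c => lit_block beta c < blocks beta n)) cl.

(** When points are removed, a falsified literal stays falsified unless its block has become
    excluded, which is inadmissible too. *)
Lemma inadmissible_sub beta q (G : gadget beta q) n cl (h h' : pred nat) :
    in_blocks beta n cl -> {subset h' <= h} ->
  inadmissible G n cl h -> inadmissible G n cl h'.
Proof.
move=> /allP hcl hh.
have ex i : i < blocks beta n -> excluded G (block q h' i) -> inadmissible G n cl h'.
  by move=> hi he; apply/orP; left; apply/existsP; exists (Ordinal hi).
have fals c : lit_block beta c < blocks beta n -> falsified G h c ->
    falsified G h' c \/ inadmissible G n cl h'.
  move=> hc /(refuted_sub (block_sub _ _ hh)) /orP[|he]; first by left.
  by right; apply: ex he.
case/or3P => [/existsP[i he]|/existsP[v /andP[hv hf]]|/hasP[l hl hf]].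
- exact: ex (excluded_sub (block_sub _ _ hh) he).
- case: (fals _ (lit_block_padding (ltn_ord v)) hf) => [hf'|//].
  by apply/or3P/Or32/existsP; exists v; rewrite hv.
case: (boolP (all (falsified G h') l)) => [h1|/allPn[c cl' h1]].
  by apply/or3P/Or33/hasP; exists l.
case: (fals c (allP (hcl _ hl) _ cl') (allP hf _ cl')) => [h2|//].
by rewrite h2 in h1.
Qed.

(** A falsified clause is witnessed by the at most [k] blocks of its literals, any other defect by a
    single block; [k.+1] covers both cases, also for [k = 0]. *)
Lemma inadmissible_local beta q (G : gadget beta q) n k cl (h : pred nat) :
    in_blocks beta n cl -> all (fun l => size l <= k) cl -> inadmissible G n cl h ->
  exists I : seq nat, [/\ size I <= k.+1, all (gtn (blocks beta n)) I &
    forall h' : pred nat, {in I, forall i, block q h' i = block q h i} ->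
      inadmissible G n cl h'].
Proof.
move=> /allP hcl /allP hk.
case/or3P => [/existsP[i he]|/existsP[v /andP[hv hf]]|/hasP[l hl hf]].
- exists [:: val i]; split=> //=; first by rewrite ltn_ord.
  move=> h' e; apply/or3P/Or31/existsP; exists i.
  by rewrite e ?inE.
- exists [:: lit_block beta (2 * v + 1)]; split=> //=; first by rewrite lit_block_padding.
  move=> h' e; apply/or3P/Or32/existsP; exists v; rewrite hv /=.
  by rewrite /falsified e ?inE.
exists [seq lit_block beta c | c <- l]; split.
- by rewrite size_map; apply: leqW; apply: hk.
- by rewrite all_map; apply: sub_all (hcl _ hl).
move=> h' e; apply/or3P/Or33/hasP; exists l => //; apply/allP => c cl'.
by rewrite /falsified e ?map_f //; apply: (allP hf).
Qed.

Definition vals n (T : {set 'I_n}) : seq nat := [seq val x | x <- enum T].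

Lemma mem_vals n (T : {set 'I_n}) (x : 'I_n) : (val x \in vals T) = (x \in T).
Proof. by rewrite mem_map ?mem_enum //; exact: val_inj. Qed.

(** A set [H] misses [T] when it lies in the complement of [T]; so [T] may serve as a constraint
    exactly when that complement is inadmissible. Taking all such [T] up to the size needed for
    locality avoids listing constraints by kind. *)
Definition exclusion_family beta q (G : gadget beta q) n k cl :
    set_family (blocks beta n * q) :=
  [set T : {set 'I_(blocks beta n * q)} | (#|T| <= k.+1 * q) &&
     inadmissible G n cl [pred y | y \notin vals T]].

Lemma hitting_exclusion_family beta q (G : gadget beta q) n k cl H :
    in_blocks beta n cl -> all (fun l => size l <= k) cl ->
  hitting_set (exclusion_family G n k cl) H = ~~ inadmissible G n cl (mem (vals H)).
Proof.
move=> hcl hk; apply/forall_inP/idP => [hit|good T].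
  apply/negP => /(inadmissible_local hcl hk) [I [sI /allP hI loc]].
  (* The complement of [H] within the witnessing blocks. Its own complement agrees with [H] on these
     blocks, hence is inadmissible, so [T] is a constraint missed by [H]. *)
  pose T := [set x : 'I_(blocks beta n * q) | (x %/ q \in I) && (x \notin H)].
  have TF : T \in exclusion_family G n k cl.
    rewrite inE; apply/andP; split.
      rewrite cardE -(size_map val); apply: (@leq_trans (size I * q));
        last by rewrite leq_mul2r sI orbT.
      have -> : size I * q = size [seq i * q + e | i <- I, e <- iota 0 q].
        by rewrite size_allpairs size_iota.
      apply: uniq_leq_size; first by rewrite (map_inj_uniq val_inj) enum_uniq.
      move=> y /mapP[x]; rewrite mem_enum inE => /andP[h1 _] -> /=.
      apply/allpairsP; exists (x %/ q, x %% q) => /=; rewrite h1 mem_iota /= add0n -divn_eq.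
      by rewrite ltn_mod; split=> //; exact: leq_ltn_trans (leq0n _) (ltn_ord (gpt G)).
    apply: loc => i iI; apply/setP => e; rewrite !inE.
    have hy : i * q + e < blocks beta n * q.
      have := hI _ iI; rewrite inE -(leq_pmul2r (leq_ltn_trans (leq0n e) (ltn_ord e))) mulSn.
      have := ltn_ord e; clear; lia.
    have q0 : 0 < q by apply: leq_ltn_trans (ltn_ord e).
    rewrite -[i * q + e]/(val (Ordinal hy)) !mem_vals inE /= divnMDl //.
    by rewrite divn_small // addn0 iI negbK.
  have /finset.set0Pn[x] := hit _ TF; rewrite !inE => /andP[xH /andP[_]].
  by rewrite xH.
(* Conversely, an [H] missing [T] is contained in an inadmissible set. *)
rewrite inE => /andP[_ hT]; apply: contra good => /eqP HT.
apply: inadmissible_sub hcl _ hT => y; rewrite !inE => /mapP[x].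
rewrite mem_enum => xH ->; rewrite mem_vals; apply/negP => xT.
by have := finset.in_set0 x; rewrite -HT inE xH xT.
Qed.

Lemma point_subproof N q (i : 'I_N) (e : 'I_q) : i * q + e < N * q.
Proof.
have := ltn_ord i; rewrite -(leq_pmul2r (leq_ltn_trans (leq0n e) (ltn_ord e))) mulSn.
by have := ltn_ord e; clear; lia.
Qed.

Definition point N q (i : 'I_N) (e : 'I_q) : 'I_(N * q) := Ordinal (point_subproof i e).

Lemma pointP N q (x : 'I_(N * q)) : exists i e, x = point i e :> 'I_(N * q).
Proof.
have q0 : 0 < q by case: q x => // -[x]; rewrite muln0.
have hi : x %/ q < N by rewrite ltn_divLR.
have he : x %% q < q by rewrite ltn_mod.
by exists (Ordinal hi), (Ordinal he); apply/val_inj; rewrite /= -divn_eq.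
Qed.

Lemma point_inj N q (i i' : 'I_N) (e e' : 'I_q) :
  (point i e == point i' e') = (i == i') && (e == e').
Proof.
have q0 : 0 < q by apply: leq_ltn_trans (ltn_ord e).
apply/eqP/andP => [[h]|[/eqP -> /eqP ->]] //; split; apply/eqP/val_inj.
  by have := congr1 (fun x => x %/ q) h; rewrite !divnMDl // !divn_small // !addn0.
by have := congr1 (fun x => x %% q) h; rewrite !modnMDl // !modn_small.
Qed.

Notation set_block q H := (block q (mem (vals H))).

Lemma in_set_block N q (H : {set 'I_(N * q)}) (i : 'I_N) (e : 'I_q) :
  (e \in set_block q H i) = (point i e \in H).
Proof. by rewrite inE -mem_vals. Qed.

Lemma set_block_toggle N q (H : {set 'I_(N * q)}) (i j : 'I_N) (e : 'I_q) :
  set_block q (toggle (point j e) H) i =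
  if i == j then toggle e (set_block q H i) else set_block q H i.
Proof.
apply/setP => e'; rewrite in_set_block in_toggle point_inj.
case: eqP => [->|] /=; last by rewrite in_set_block.
by rewrite in_toggle !in_set_block.
Qed.

(** A junk block is neither excluded nor a code, so it triggers no condition and may be exchanged
    for any other junk block. *)
Lemma inadmissible_junk beta q (G : gadget beta q) n cl (h h' : pred nat) :
    in_blocks beta n cl ->
    (forall i : 'I_(blocks beta n), block q h' i = block q h i \/
       junk G (block q h' i) /\ junk G (block q h i)) ->
  inadmissible G n cl h' = inadmissible G n cl h.
Proof.
move=> /allP hcl hh.
have nref X c : junk G X -> refuted G X c = false.
  by move=> jX; apply/existsP => -[a /andP[/eqP e _]]; move: jX;
    rewrite e (negbTE (code_not_junk G a)).
have fals c : lit_block beta c < blocks beta n -> falsified G h' c = falsified G h c.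
  move=> hc; rewrite /falsified; case: (hh (Ordinal hc)) => /= [-> //|[j1 j2]].
  by rewrite !nref.
congr [|| _, _ | _].
- apply: eq_existsb => i; case: (hh i) => [-> //|[j1 j2]].
  by rewrite /excluded j1 j2.
- by apply: eq_existsb => v; rewrite fals // lit_block_padding.
by apply: eq_in_has => l /hcl /allP hl; apply: eq_in_all => c /hl; apply: fals.
Qed.

Definition has_junk beta q (G : gadget beta q) n (H : {set 'I_(blocks beta n * q)}) :=
  [exists i : 'I_(blocks beta n), junk G (set_block q H i)].

Lemma even_admissible_junk beta q (G : gadget beta q) n cl :
    in_blocks beta n cl ->
  ~~ odd #|[set H | ~~ inadmissible G n cl (mem (vals H)) & has_junk G (n := n) H]|.
Proof.
move=> hcl.
(* The block is picked from the junk predicate alone, which toggling [gpt] preserves; hence the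
   choice is stable. The default does not occur, since a junk block exists. *)
pose i0 (H : {set 'I_(blocks beta n * q)}) : 'I_(blocks beta n) :=
  odflt ord0 [pick i : 'I_(blocks beta n) | junk G (set_block q H i)].
apply: (@even_card_toggle _ _ (fun H => point (i0 H) (gpt G))) => H.
rewrite inE => /andP[h1 h2]; set H' := toggle _ H.
have jE (i : 'I_(blocks beta n)) : junk G (set_block q H' i) = junk G (set_block q H i).
  by rewrite set_block_toggle; case: eqP => // ->; apply: junk_toggle.
have e0 : i0 H' = i0 H by rewrite /i0; congr odflt; apply: eq_pick => i; apply: jE.
have j0 : junk G (set_block q H (i0 H)).
  rewrite /i0; case: pickP => // h; case/existsP: h2 => i; by rewrite h.
rewrite e0; split=> //; rewrite inE; apply/andP; split; last first.
  by case/existsP: h2 => i hi; apply/existsP; exists i; rewrite jE.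
rewrite (inadmissible_junk hcl (h := mem (vals H))) // => i.
rewrite set_block_toggle; case: eqP => [e|]; last by left.
by right; rewrite e junk_toggle.
Qed.

(** * Assignments as admissible sets *)

(** Positions from [n] on read as false, in accordance with the padding condition. *)
Definition slice beta n (a : {ffun 'I_n -> bool}) i : {ffun 'I_beta -> bool} :=
  [ffun p : 'I_beta => [exists v : 'I_n, (v == i * beta + p :> nat) && a v]].
Arguments slice : clear implicits.

Definition code_set beta q (G : gadget beta q) n (a : {ffun 'I_n -> bool}) :
    {set 'I_(blocks beta n * q)} :=
  [set x : 'I_(blocks beta n * q) |
     [exists e : 'I_q, (e == x %% q :> nat) && (e \in gcode G (slice beta n a (x %/ q)))]].

Lemma block_code_set beta q (G : gadget beta q) n a (i : 'I_(blocks beta n)) :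
  set_block q (code_set G (n := n) a) i = gcode G (slice beta n a i).
Proof.
apply/setP => e; rewrite in_set_block inE /=.
have q0 : 0 < q by apply: leq_ltn_trans (ltn_ord e).
rewrite divnMDl // divn_small // addn0 modnMDl modn_small //.
apply/existsP/idP => [[e' /andP[/eqP/val_inj -> //]]|he].
by exists e; rewrite eqxx.
Qed.

Lemma slice_at beta n (a : {ffun 'I_n -> bool}) i (p : 'I_beta) (v : 'I_n) :
  v = i * beta + p :> nat -> slice beta n a i p = a v.
Proof.
move=> e; rewrite ffunE; apply/existsP/idP => [[w /andP[/eqP ew]]|av].
  by have -> : w = v by apply/val_inj; rewrite /= ew e.
by exists v; rewrite e eqxx.
Qed.

Lemma refuted_code beta q (G : gadget beta q) a c (p : 'I_beta) :
  p = (c %% (2 * beta))./2 :> nat -> refuted G (gcode G a) c = (a p == odd c).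
Proof.
move=> hp; apply/existsP/idP => [[b /andP[/eqP/gcode_inj <- /existsP[p' /andP[/eqP e]]]]|h].
  by have -> : p' = p by apply/val_inj; rewrite /= e hp.
by exists a; rewrite eqxx; apply/existsP; exists p; rewrite hp eqxx.
Qed.

Lemma literal_code_split beta n (l : literal n) : 0 < beta ->
  [/\ lit_block beta (literal_code l) = l.1 %/ beta,
      (literal_code l %% (2 * beta))./2 = l.1 %% beta & odd (literal_code l) = ~~ l.2].
Proof.
move=> b0; rewrite /literal_code; have hb : (~~ l.2 : nat) < 2 by case: l.2.
have eE : 2 * l.1 + ~~ l.2 = l.1 %/ beta * (2 * beta) + (2 * (l.1 %% beta) + ~~ l.2).
  by rewrite {1}(divn_eq l.1 beta) mulnDr mulnCA addnA.
have lt : 2 * (l.1 %% beta) + ~~ l.2 < 2 * beta.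
  by have := ltn_pmod l.1 b0; move: hb; clear; lia.
rewrite /lit_block; split.
- by rewrite eE divnMDl ?muln_gt0 // (divn_small lt) addn0.
- by rewrite eE modnMDl (modn_small lt) addnC mul2n half_bit_double.
- by rewrite oddD mul2n odd_double; case: l.2.
Qed.

Lemma lit_block_literal beta n (l : literal n) : 0 < beta ->
  lit_block beta (literal_code l) < blocks beta n.
Proof.
move=> b0; have [-> _ _] := literal_code_split l b0.
by rewrite ltnS leq_div2r // ltnW.
Qed.

Lemma falsified_code_set beta q (G : gadget beta q) n (a : {ffun 'I_n -> bool})
    (l : literal n) : 0 < beta ->
  falsified G (mem (vals (code_set G a))) (literal_code l) = (a l.1 != l.2).
Proof.
move=> b0; rewrite /falsified; have := lit_block_literal l b0.
have [-> hp ho] := literal_code_split l b0 => hi.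
rewrite -[_ %/ _]/(val (Ordinal hi)) block_code_set.
rewrite (@refuted_code _ _ _ _ _ (Ordinal (ltn_pmod l.1 b0))) ?hp //.
rewrite (@slice_at _ _ _ _ _ l.1) /= -?divn_eq // ho.
by case: (a _); case: l.2.
Qed.

Lemma lists_cnf_satisfies n (phi : cnf n) L a : lists_family phi L ->
  satisfies a phi = ~~ has (all (fun l : literal n => a l.1 != l.2)) L.
Proof.
move=> /lists_familyP[_ _ h3]; rewrite -all_predC; apply/forall_inP/allP => [h l lL|h C].
  have := h [set x in l]; rewrite h3 map_f // => /(_ isT) /existsP[x /andP[]].
  rewrite inE => xl hx; apply/negP => /allP /(_ _ xl).
  by rewrite hx.
rewrite h3 => /mapP[l lL ->]; have /= /allPn[x xl /negPn hx] := h _ lL.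
by apply/existsP; exists x; rewrite inE xl.
Qed.

Lemma admissible_code_set beta q (G : gadget beta q) n (phi : cnf n) L
    (a : {ffun 'I_n -> bool}) :
    0 < beta -> lists_family phi L ->
  ~~ inadmissible G n [seq [seq literal_code x | x <- l] | l <- L]
       (mem (vals (code_set G a))) = satisfies a phi.
Proof.
move=> b0 hL; rewrite (lists_cnf_satisfies _ hL); congr (~~ _).
rewrite /inadmissible.
have -> : [exists i : 'I_(blocks beta n), excluded G (set_block q (code_set G a) i)] = false.
  by apply/existsP => -[i]; rewrite block_code_set (negbTE (code_not_excluded _ _)).
have -> : [exists v : 'I_(blocks beta n * beta), (n <= v) &&
    falsified G (mem (vals (code_set G a))) (2 * v + 1)] = false.
  apply/existsP => -[v /andP[hv]].
  have hi : v %/ beta < blocks beta n by rewrite ltn_divLR.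
  (* A padding variable is no variable of the formula, so the literal is taken over
     [blocks beta n * beta] variables; its code is [2 * v + 1]. *)
  have := @literal_code_split beta _ (v, false) b0.
  rewrite /literal_code /= => -[e1 e2 e3].
  rewrite /falsified e1 -[_ %/ _]/(val (Ordinal hi)) block_code_set.
  rewrite (@refuted_code _ _ _ _ _ (Ordinal (ltn_pmod v b0))) ?e2 // e3 ffunE eqb_id.
  case/existsP => w /andP[/eqP /=]; rewrite -divn_eq => e.
  by move: hv; rewrite -e leqNgt ltn_ord.
rewrite /= has_map; apply: eq_has => l /=; rewrite all_map; apply: eq_all => x /=.
exact: falsified_code_set.
Qed.

Lemma code_set_inj beta q (G : gadget beta q) n : 0 < beta ->
  injective (@code_set beta q G n).
Proof.
move=> b0 a b e; apply/ffunP => v.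
have hi : v %/ beta < blocks beta n by rewrite ltnS leq_div2r // ltnW.
have := block_code_set G a (Ordinal hi); rewrite e block_code_set => /gcode_inj h.
have := congr1 (fun s : {ffun 'I_beta -> bool} => s (Ordinal (ltn_pmod v b0))) h.
by rewrite !(@slice_at _ _ _ _ _ v) //= -divn_eq.
Qed.

Lemma admissible_no_junk beta q (G : gadget beta q) n cl
    (H : {set 'I_(blocks beta n * q)}) :
    0 < beta -> ~~ inadmissible G n cl (mem (vals H)) -> ~~ has_junk G H ->
  exists a, H = code_set G a.
Proof.
move=> b0; rewrite !negb_or negb_exists => /and3P[/forallP h1 h2 _].
rewrite negb_exists => /forallP h3.
have ex (i : 'I_(blocks beta n)) : exists a, set_block q H i = gcode G a.
  have := h1 i; rewrite /excluded h3 /= negbK => /existsP[a /eqP]; by exists a.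
have [s hs] := fin_all_exists ex.
have hb (v : 'I_n) : v %/ beta < blocks beta n by rewrite ltnS leq_div2r // ltnW.
pose a := [ffun v : 'I_n => s (Ordinal (hb v)) (Ordinal (ltn_pmod v b0))].
exists a; apply/setP => x; have [i [e ->]] := pointP x.
rewrite -!in_set_block block_code_set hs; congr (e \in gcode G _).
apply/ffunP => p; set v := i * beta + p.
have vi : v %/ beta = i by rewrite divnMDl // divn_small // addn0.
have vp : v %% beta = p by rewrite modnMDl modn_small.
case: (ltnP v n) => hv.
  rewrite (@slice_at _ _ _ _ _ (Ordinal hv)) // ffunE; congr (s _ _); exact/val_inj.
rewrite ffunE; have -> : [exists w : 'I_n, (w == i * beta + p :> nat) && a w] = false.
  apply/existsP => -[w /andP[/eqP ew _]].
  by move: hv; rewrite /v -ew leqNgt ltn_ord.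
have hvN : v < blocks beta n * beta by exact: (point_subproof i p).
move: h2; rewrite negb_exists => /forallP /(_ (Ordinal hvN)); rewrite /= hv /=.
have := @literal_code_split beta _ (Ordinal hvN, false) b0.
rewrite /literal_code /= => -[e1 e2 e3].
rewrite /falsified e1 vi hs (@refuted_code _ _ _ _ _ p) ?e2 ?vp // e3.
by case: (s i p).
Qed.

Lemma parity_admissible beta q (G : gadget beta q) n (phi : cnf n) L :
    0 < beta -> lists_family phi L ->
  odd #|[set H : {set 'I_(blocks beta n * q)} |
          ~~ inadmissible G n [seq [seq literal_code x | x <- l] | l <- L]
                      (mem (vals H))]| =
  odd #|[set a | satisfies a phi]|.
Proof.
move=> b0 hL; set cl := [seq _ | _ <- L]; set A := [set H : {set _} | _].
have hcl : in_blocks beta n cl.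
  rewrite /in_blocks all_map; apply/allP => l _ /=; rewrite all_map.
  by apply/allP => x _; apply: lit_block_literal.
rewrite -(cardsID [set H | has_junk G (n := n) H] A) oddD.
have -> : A :&: [set H | has_junk G (n := n) H] =
    [set H | ~~ inadmissible G n cl (mem (vals H)) & has_junk G (n := n) H].
  by apply/setP => H; rewrite !inE.
rewrite (negbTE (even_admissible_junk _ hcl)) /=.
rewrite -(card_imset _ (@code_set_inj _ _ G n b0)); congr (odd #|pred_of_set _|).
apply/setP => H; rewrite !inE; apply/andP/imsetP => [[h1 h2]|[a]].
  have [a e] := admissible_no_junk b0 h2 h1.
  by exists a => //; rewrite inE -(admissible_code_set G a b0 hL) -e.
rewrite inE => ha ->; rewrite (admissible_code_set G a b0 hL) ha; split=> //.
apply/existsP => -[i]; rewrite block_code_set; exact/negP/code_not_junk.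
Qed.

(** * Numbering the small sets *)

(* The number [c] stands for the list of the [c %% s.+1] lowest digits of
   [c %/ s.+1] in base [b]; the exponent is capped at [s] only in order to be
   visibly bounded. *)
Definition cand_size s c := c %% s.+1.

Definition cand_digit b s c e := (c %/ s.+1 %/ b ^ minn e s) %% b.

Definition cand b s c := mkseq (cand_digit b s c) (cand_size s c).

(** No digits beyond the listed ones, and an increasing list: every set of at most [s] numbers below
    [b] then has exactly one canonical number. *)
Definition canonical b s c :=
  (c %/ s.+1 < b ^ minn (cand_size s c) s) && sorted ltn (cand b s c).

Lemma cand_size_leq s c : cand_size s c <= s.
Proof. by rewrite -ltnS ltn_mod. Qed.

Lemma nth_undig b l e : all (gtn b) l -> e < size l ->
  (undig b l %/ b ^ e) %% b = nth 0 l e.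
Proof.
elim: l e => // d l IH e /= /andP[db hl].
have b0 : 0 < b by apply: leq_ltn_trans db.
case: e => [|e] he; first by rewrite divn1 mulnC addnC modnMDl modn_small.
by rewrite expnS divnMA mulnC addnC divnMDl // (divn_small db) addn0 IH.
Qed.

Lemma undig_digits b v s : v < b ^ s -> undig b (mkseq (fun e => v %/ b ^ e %% b) s) = v.
Proof.
elim: s v => [|s IH] v hv; first by case: v hv.
have b0 : 0 < b by case: b hv {IH} => //; rewrite exp0n.
rewrite /mkseq /= divn1 (iotaDl 1 0) -map_comp.
rewrite [X in undig b X](_ : _ = mkseq (fun e => (v %/ b) %/ b ^ e %% b) s).
  by rewrite IH ?ltn_divLR -?expnSr // addnC mulnC -divn_eq.
by apply: eq_map => e /=; rewrite add1n expnS divnMA.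
Qed.

Lemma cand_digits b s c :
  cand b s c = mkseq (fun e => c %/ s.+1 %/ b ^ e %% b) (cand_size s c).
Proof.
apply/eq_in_map => e; rewrite mem_iota /= => he.
by rewrite /cand_digit (minn_idPl _) // ltnW // (leq_trans he) // cand_size_leq.
Qed.

Lemma cand_lt b s c : 0 < b -> all (gtn b) (cand b s c).
Proof. by move=> b0; apply/allP => y /mapP[e _ ->]; rewrite inE ltn_mod. Qed.

Lemma cand_inj b s : {in canonical b s &, injective (cand b s)}.
Proof.
move=> c c' /andP[h _] /andP[h' _] e.
have es : cand_size s c = cand_size s c' by have := congr1 size e; rewrite !size_mkseq.
move: h h'; rewrite !(minn_idPl (cand_size_leq _ _)) => h h'.
have ev : c %/ s.+1 = c' %/ s.+1.
  rewrite -(undig_digits h) -(undig_digits h') -!cand_digits.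
  by rewrite -/(cand_digit _ _ _) e.
by rewrite (divn_eq c s.+1) (divn_eq c' s.+1) ev -!/(cand_size s _) es.
Qed.

Lemma cand_surj b s l : 0 < b -> sorted ltn l -> all (gtn b) l -> size l <= s ->
  exists c, [/\ c < b ^ s * s.+1, canonical b s c & cand b s c = l].
Proof.
move=> b0 srt hl hs; pose c := undig b l * s.+1 + size l.
have hc : c %/ s.+1 = undig b l by rewrite divnMDl // divn_small // addn0.
have hz : cand_size s c = size l by rewrite /cand_size modnMDl modn_small.
have e : cand b s c = l.
  rewrite cand_digits hc hz; apply: (@eq_from_nth _ 0); rewrite size_mkseq // => i hi.
  by rewrite nth_mkseq // nth_undig.
have lt := undig_lt hl.
exists c; split=> //; last by rewrite /canonical e hc hz (minn_idPl hs) lt.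
apply: (@leq_trans ((undig b l).+1 * s.+1)); first by rewrite /c mulSn [X in _ < X]addnC ltn_add2l.
by rewrite leq_mul2r /= (leq_trans lt) // leq_pexp2l.
Qed.

Lemma vals_sorted n (T : {set 'I_n}) : sorted ltn (vals T).
Proof.
rewrite /vals /enum_mem -enumT sorted_map.
apply: sorted_filter; first by move=> x y z; apply: ltn_trans.
by rewrite -sorted_map val_enum_ord iota_ltn_sorted.
Qed.

Lemma vals_lt n (T : {set 'I_n}) : all (gtn n) (vals T).
Proof. by apply/allP => y /mapP[x _ ->]; exact: (ltn_ord x). Qed.

Definition ords n (l : seq nat) : seq 'I_n := pmap insub l.

Lemma map_val_ords n l : all (gtn n) l -> [seq val x | x <- ords n l] = l.
Proof.
elim: l => //= x l IH /andP[hx /IH e]; rewrite /ords /= insubT //= -/(ords n l).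
by rewrite e.
Qed.

Lemma sorted_lt_eq (s1 s2 : seq nat) : sorted ltn s1 -> sorted ltn s2 -> s1 =i s2 -> s1 = s2.
Proof. by apply: irr_sorted_eq; [exact: ltn_trans|exact: ltnn]. Qed.

Lemma vals_ords n l : sorted ltn l -> all (gtn n) l -> vals [set x in ords n l] = l.
Proof.
move=> h1 h2; apply: sorted_lt_eq => // [|y]; first exact: vals_sorted.
rewrite -[in RHS](map_val_ords h2).
by apply/mapP/mapP => -[x hx ->]; exists x => //; rewrite ?mem_enum inE in hx *.
Qed.

Lemma inadmissible_ext beta q (G : gadget beta q) n cl (h h' : pred nat) :
  h =1 h' -> inadmissible G n cl h = inadmissible G n cl h'.
Proof. by move=> /funext ->. Qed.

Definition excluded_cand beta q (G : gadget beta q) n s cl c :=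
  let b := blocks beta n * q in
  canonical b s c && inadmissible G n cl [pred y | y \notin cand b s c].

Lemma lists_exclusion_family beta q (G : gadget beta q) n k cl :
  let b := blocks beta n * q in let s := k.+1 * q in
  is_true (lists_family (exclusion_family G n k cl)
    [seq ords b (cand b s c) |
       c <- [seq c <- iota 0 (b ^ s * s.+1) | excluded_cand G n s cl c]]).
Proof.
move=> b s; have b0 : 0 < b by rewrite muln_gt0 /= (leq_ltn_trans (leq0n _) (ltn_ord (gpt G))).
have candP c : canonical b s c -> sorted ltn (cand b s c) by case/andP.
have vE c : canonical b s c -> vals [set x in ords b (cand b s c)] = cand b s c.
  by move=> hc; apply: vals_ords (candP _ hc) (cand_lt _ _ b0).
apply/lists_familyP; split.
- apply/allP => y /mapP[c]; rewrite mem_filter => /andP[/andP[hc _] _] ->.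
  rewrite -(map_inj_uniq val_inj) map_val_ords ?cand_lt //.
  exact: (sorted_uniq ltn_trans ltnn) (candP _ hc).
- rewrite -map_comp map_inj_in_uniq; first by rewrite filter_uniq ?iota_uniq.
  move=> c c'; rewrite !mem_filter => /andP[/andP[hc _] _] /andP[/andP[hc' _] _] /= e.
  by apply: (cand_inj (b := b) (s := s)) => //; rewrite -(vE _ hc) -(vE _ hc') e.
move=> T; rewrite -map_comp inE; apply/andP/mapP => [[h1 h2]|[c]].
  have sT : size (vals T) <= s by rewrite size_map -cardE.
  have [c [c1 c2 c3]] := cand_surj b0 (vals_sorted T) (vals_lt T) sT.
  exists c; first by rewrite mem_filter /excluded_cand c2 c3 h2 mem_iota.
  apply/setP => x; rewrite /= inE c3 -mem_vals -[in LHS](map_val_ords (vals_lt T)).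
  by rewrite mem_map //; exact: val_inj.
rewrite mem_filter => /andP[/andP[hc hi] _] -> /=; split.
  by rewrite cardE -(size_map val) -/(vals _) vE // size_mkseq cand_size_leq.
by rewrite (@inadmissible_ext _ _ _ _ _ _ [pred y | y \notin cand b s c]) // => y /=; rewrite vE.
Qed.

Lemma cnf_to_hitting_set beta q (G : gadget beta q) k n w b0 : 0 < beta ->
  parity_cnf_sat k n w b0 -> exists cl, w = encode_lists n cl /\
    let b := blocks beta n * q in let s := k.+1 * q in
    parity_hitting_set s b (encode_lists b [seq cand b s c |
       c <- [seq c <- iota 0 (b ^ s * s.+1) | excluded_cand G n s cl c]]) b0.
Proof.
move=> beta0 [phi [h1 [L hL ->] ->]]; eexists; split; first by [].
set cl := [seq _ | _ <- L] => b s.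
have bq : 0 < b by rewrite muln_gt0 /= (leq_ltn_trans (leq0n _) (ltn_ord (gpt G))).
have hcl : in_blocks beta n cl.
  rewrite /in_blocks all_map; apply/allP => l _ /=; rewrite all_map.
  by apply/allP => x _; apply: lit_block_literal.
have hk : all (fun l => size l <= k) cl.
  rewrite all_map; apply/allP => l lL /=; rewrite size_map.
  have /lists_familyP[/allP u _ h3] := hL; rewrite -(card_uniqP (u _ lL)).
  by have := forall_inP h1 [set x in l]; rewrite h3 map_f // cardsE => ->.
exists (exclusion_family G n k cl); split.
- by apply/forall_inP => T; rewrite inE => /andP[].
- exists [seq ords b (cand b s c) |
       c <- [seq c <- iota 0 (b ^ s * s.+1) | excluded_cand G n s cl c]].
    exact: lists_exclusion_family.
  by congr encode_lists; rewrite -map_comp; apply: eq_map => c /=; rewrite map_val_ords ?cand_lt.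
rewrite -(parity_admissible G beta0 hL); congr (odd #|pred_of_set _|).
by apply/setP => H; rewrite !inE hitting_exclusion_family.
Qed.

(** At most one pair [(c, e)] has offset [i]. The formula uses only sums, comparisons and products,
    under which [cmp] is closed, and yields the default 0 past the end. *)
Lemma nth_flatten_iota (F : nat -> seq nat) C i :
  nth 0 (flatten [seq F c | c <- iota 0 C]) i =
  \sum_(c < C) \sum_(e < size (F c))
     (\sum_(d < c) size (F d) + e == i) * nth 0 (F c) e.
Proof.
have szE m : size (flatten [seq F c | c <- iota 0 m]) = \sum_(d < m) size (F d).
  elim: m => [|m IH]; first by rewrite big_ord0.
  by rewrite -addn1 iotaD map_cat flatten_cat size_cat IH addn1 big_ord_recr /= cats0.
elim: C => [|C IH]; first by rewrite big_ord0 nth_nil.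
rewrite big_ord_recr -IH -[C.+1 in LHS]addn1 iotaD map_cat flatten_cat nth_cat szE /= cats0 add0n.
set P := \sum_(d < C) _; case: ltnP => hi.
  rewrite big1 ?addn0 // => e _; case: eqP => // h; move: hi; rewrite -h.
  by rewrite ltnNge leq_addr.
rewrite [nth 0 (flatten _) i]nth_default ?szE // add0n.
case: (ltnP (i - P) (size (F C))) => hs.
  rewrite (bigD1 (Ordinal hs)) //= subnKC // eqxx mul1n big1 ?addn0 // => e /eqP ne.
  by case: eqP => // h; case: ne; apply/val_inj; rewrite /= -h addKn.
rewrite nth_default // big1 // => e _; case: eqP => // h.
by move: hs; rewrite -h addKn leqNgt ltn_ord.
Qed.

Lemma rows_filter (P : pred nat) (f : nat -> seq nat) (s : seq nat) :
  rows [seq f c | c <- [seq c <- s | P c]] =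
  flatten [seq (if P c then size (f c) :: f c else [::]) | c <- s].
Proof. by elim: s => //= c s; case: (P c) => //=; rewrite /rows /= => ->. Qed.

Lemma cmp_cand_size k s (c : ctx k -> nat) : cmp k c -> cmp k (fun g => cand_size s (c g)).
Proof. move=> h; exact: (@cmp_modn k c (fun=> s.+1) h (cmp_cst _ _)). Qed.

Lemma cmp_cand_digit k s (b c e : ctx k -> nat) :
  cmp k b -> cmp k c -> cmp k e -> cmp k (fun g => cand_digit (b g) s (c g) (e g)).
Proof.
move=> hb hc he.
exact: cmp_modn (cmp_divn (cmp_divn hc (cmp_cst _ _)) (cmp_expn_minn s hb he)) hb.
Qed.

Lemma cmpb_mem_cand k s (b c y : ctx k -> nat) :
  cmp k b -> cmp k c -> cmp k y -> cmpb k (fun g => y g \in cand (b g) s (c g)).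
Proof.
move=> hb hc hy.
apply: (@cmpb_eq _ _ (fun g =>
   [exists e : 'I_(cand_size s (c g)), cand_digit (b g) s (c g) e == y g])).
  move=> g; apply/mapP/existsP => [[e]|[e /eqP <-]].
    by rewrite mem_iota /= => he ->; exists (Ordinal he); rewrite eqxx.
  by exists (val e); rewrite // mem_iota /=.
apply: (@cmpb_exists _ (fun g => cand_size s (c g))
   (fun g e => cand_digit (b g) s (c g) e == y g)); first exact: cmp_cand_size.
apply: cmpb_eqn; last exact: cmp_weaken.
by apply: cmp_cand_digit _ _ (cmp_var _); exact: cmp_weaken.
Qed.

Lemma cmpb_canonical k s (b c : ctx k -> nat) :
  cmp k b -> cmp k c -> cmpb k (fun g => canonical (b g) s (c g)).
Proof.
move=> hb hc; apply: cmpb_and.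
  apply: cmpb_ltn; first exact: cmp_divn hc (cmp_cst _ _).
  by apply: cmp_expn_minn => //; exact: cmp_cand_size.
apply: (@cmpb_eq _ _ (fun g => [forall e : 'I_(cand_size s (c g) - 1),
    cand_digit (b g) s (c g) e < cand_digit (b g) s (c g) e.+1])).
  move=> g; apply/(sortedP 0)/forallP => [h e|h e]; last rewrite size_mkseq => he.
    have he : e.+1 < cand_size s (c g) by have := ltn_ord e; clear; lia.
    by have := h e; rewrite size_mkseq => /(_ he); rewrite !nth_mkseq // ltnW.
  have he' : e < cand_size s (c g) - 1 by move: he; clear; lia.
  by have := h (Ordinal he'); rewrite !nth_mkseq // ltnW.
apply: (@cmpb_forall _ (fun g => cand_size s (c g) - 1) (fun g e =>
    cand_digit (b g) s (c g) e < cand_digit (b g) s (c g) e.+1)).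
  exact: cmpB (cmp_cand_size _ hc) (cmp_cst _ _).
have hv := cmp_var k.
have hb' := cmp_weaken hb; have hc' := cmp_weaken hc.
exact: cmpb_ltn (cmp_cand_digit _ hb' hc' hv) (cmp_cand_digit _ hb' hc' (cmpS hv)).
Qed.

Notation co_cand b s c := [pred y | y \notin cand b s c].

Lemma cmp_block_cand k q s (Phi : {set 'I_q} -> nat) (b c i : ctx k -> nat) :
  cmp k b -> cmp k c -> cmp k i ->
  cmp k (fun g => Phi (block q (co_cand (b g) s (c g)) (i g))).
Proof.
move=> hb hc hi.
apply: (@cmp_finset _ _ Phi (fun g e => i g * q + e \notin cand (b g) s (c g))).
apply: cmpb_not; apply: (@cmpb_mem_cand k.+1 s (fun p => b p.1) (fun p => c p.1)
  (fun p => i p.1 * q + p.2)); try exact: cmp_weaken.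
exact: cmpD (cmpM (cmp_weaken hi) (cmp_cst _ _)) (cmp_var _).
Qed.

Lemma refuted_mod beta q (G : gadget beta q) X c :
  refuted G X (c %% (2 * beta)) = refuted G X c.
Proof.
rewrite /refuted modn_mod; have -> // : odd (c %% (2 * beta)) = odd c.
by rewrite {2}(divn_eq c (2 * beta)) oddD !oddM /= andbF.
Qed.

(** The block number is obtained by division; the rest of the literal is a residue modulo the
    constant [2 * beta], and for each residue [refuted] is a finite table on the block. *)
Lemma cmpb_falsified_cand beta q (G : gadget beta q) k s (b c x : ctx k -> nat) :
  0 < beta -> cmp k b -> cmp k c -> cmp k x ->
  cmpb k (fun g => falsified G (co_cand (b g) s (c g)) (x g)).
Proof.
move=> b0 hb hc hx.
apply: (@cmp_eq _ _ (fun g => if x g %% (2 * beta) < 2 * beta then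
   refuted G (block q (co_cand (b g) s (c g)) (lit_block beta (x g)))
     (x g %% (2 * beta)) : nat else 0)).
  by move=> g; rewrite ltn_mod muln_gt0 b0 /= refuted_mod.
apply: (@cmp_cases k (2 * beta) (fun g => x g %% (2 * beta)) (fun j g =>
   refuted G (block q (co_cand (b g) s (c g)) (lit_block beta (x g))) j : nat)).
  exact: cmp_modn hx (cmp_cst _ _).
move=> j _; apply: (@cmp_block_cand k q s (fun X => refuted G X j : nat)) => //.
exact: cmp_divn hx (cmp_cst _ _).
Qed.

(** * The exclusion family computed from the memory *)

Definition universe beta q (M : nat -> nat) := blocks beta (M 0) * q.

Definition excluded_cand_mem beta q (G : gadget beta q) s (M : nat -> nat) c :=
  let b := universe beta q M in let h := co_cand b s c in
  canonical b s c &&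
  [|| [exists i : 'I_(blocks beta (M 0)), excluded G (block q h i)],
      [exists v : 'I_(blocks beta (M 0) * beta), (M 0 <= v) && falsified G h (2 * v + 1)]
    | [exists j : 'I_(M 1), [forall t : 'I_(M (start M j)),
         falsified G h (M (start M j + t.+1))]]].

Lemma excluded_cand_memE beta q (G : gadget beta q) s n cl c :
  excluded_cand_mem G s (nth 0 (encode_lists n cl)) c = excluded_cand G n s cl c.
Proof.
rewrite /excluded_cand_mem /excluded_cand /inadmissible.
by rewrite (exists_row n cl (falsified G _)).
Qed.

Lemma cmp_blocks k beta : cmp k (fun g => blocks beta (ctx_mem g 0)).
Proof. by apply/cmpS/cmp_divn; [exact/cmp_mem/cmp_cst|exact: cmp_cst]. Qed.

Lemma cmp_universe k beta q : cmp k (fun g => universe beta q (ctx_mem g)).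
Proof. exact: cmpM (cmp_blocks _ _) (cmp_cst _ _). Qed.

Lemma cmpb_excluded_cand beta q (G : gadget beta q) s k (c : ctx k -> nat) :
  0 < beta -> cmp k c -> cmpb k (fun g => excluded_cand_mem G s (ctx_mem g) (c g)).
Proof.
move=> b0 hc; have hb := cmp_universe k beta q.
have hb1 : cmp k.+1 (fun p => universe beta q (ctx_mem p.1)) := cmp_weaken hb.
have hc1 : cmp k.+1 (fun p => c p.1) := cmp_weaken hc.
have hm : cmp k (fun g => ctx_mem g 0) by exact/cmp_mem/cmp_cst.
apply: cmpb_and; first exact: cmpb_canonical.
apply: cmpb_or; [|apply: cmpb_or].
- apply: (@cmpb_exists _ (fun g => blocks beta (ctx_mem g 0)) (fun g i =>
    excluded G (block q (co_cand (universe beta q (ctx_mem g)) s (c g)) i))).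
    exact: cmp_blocks.
  exact: (@cmp_block_cand k.+1 q s (fun X => excluded G X : nat) _ _ _ hb1 hc1 (cmp_var k)).
- apply: (@cmpb_exists _ (fun g => blocks beta (ctx_mem g 0) * beta) (fun g v =>
    (ctx_mem g 0 <= v) &&
    falsified G (co_cand (universe beta q (ctx_mem g)) s (c g)) (2 * v + 1))).
    exact: cmpM (cmp_blocks _ _) (cmp_cst _ _).
  apply: cmpb_and; first exact: cmpb_leq (cmp_weaken hm) (cmp_var k).
  apply: (@cmpb_falsified_cand _ _ G k.+1 s _ _ (fun p => 2 * p.2 + 1) b0 hb1 hc1).
  exact: cmpD (cmpM (cmp_cst _ _) (cmp_var k)) (cmp_cst _ _).
apply: (@cmpb_pred_row k (fun g x =>
  falsified G (co_cand (universe beta q (ctx_mem g)) s (c g)) x)).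
exact: (@cmpb_falsified_cand _ _ G k.+1 s _ _ _ b0 hb1 hc1 (cmp_var k)).
Qed.

Definition cand_count beta q s (M : nat -> nat) := universe beta q M ^ s * s.+1.

Lemma cmp_cand_count k beta q s : cmp k (fun g => cand_count beta q s (ctx_mem g)).
Proof.
apply: cmpM _ (cmp_cst _ _).
apply: (@cmp_eq _ _ (fun g => universe beta q (ctx_mem g) ^ minn s s)).
  by move=> g; rewrite minnn.
exact: cmp_expn_minn (cmp_universe _ _ _) (cmp_cst _ _).
Qed.

Definition row_size beta q (G : gadget beta q) s M c :=
  if excluded_cand_mem G s M c then (cand_size s c).+1 else 0.

(** Position 0 of a row is its length header, whence the shift by one. *)
Definition row_entry beta q s M c e :=
  if e == 0 then cand_size s c else cand_digit (universe beta q M) s c (e - 1).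

Definition row_total beta q (G : gadget beta q) s M c := \sum_(d < c) row_size G s M d.

Definition row_cell beta q (G : gadget beta q) s M i :=
  \sum_(c < cand_count beta q s M) \sum_(e < row_size G s M c)
    (row_total G s M c + e == i) * row_entry beta q s M c e.

Lemma cmp_row_size beta q (G : gadget beta q) s k (c : ctx k -> nat) :
  0 < beta -> cmp k c -> cmp k (fun g => row_size G s (ctx_mem g) (c g)).
Proof.
move=> b0 hc; apply: cmp_if; [exact: cmpb_excluded_cand|apply: cmpS|exact: cmp_cst].
exact: cmp_cand_size.
Qed.

Lemma cmp_row_total beta q (G : gadget beta q) s k (c : ctx k -> nat) :
  0 < beta -> cmp k c -> cmp k (fun g => row_total G s (ctx_mem g) (c g)).
Proof.
move=> b0 hc; apply: (@cmp_sum _ c (fun g d => row_size G s (ctx_mem g) d)) => //.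
exact: (@cmp_row_size _ _ G s k.+1 _ b0 (cmp_var k)).
Qed.

Lemma cmp_row_entry beta q s k (c e : ctx k -> nat) :
  cmp k c -> cmp k e -> cmp k (fun g => row_entry beta q s (ctx_mem g) (c g) (e g)).
Proof.
move=> hc he; apply: cmp_if; first exact: cmpb_eqn he (cmp_cst _ _).
  exact: cmp_cand_size.
exact: cmp_cand_digit (cmp_universe _ _ _) hc (cmpB he (cmp_cst _ _)).
Qed.

Lemma cmp_row_cell beta q (G : gadget beta q) s k (i : ctx k -> nat) :
  0 < beta -> cmp k i -> cmp k (fun g => row_cell G s (ctx_mem g) (i g)).
Proof.
move=> b0 hi.
apply: (@cmp_sum _ (fun g => cand_count beta q s (ctx_mem g)) (fun g c =>
  \sum_(e < row_size G s (ctx_mem g) c)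
    (row_total G s (ctx_mem g) c + e == i g) * row_entry beta q s (ctx_mem g) c e)).
  exact: cmp_cand_count.
apply: (@cmp_sum k.+1 (fun p => row_size G s (ctx_mem p) p.2) (fun p e =>
    (row_total G s (ctx_mem p) p.2 + e == i p.1) * row_entry beta q s (ctx_mem p) p.2 e)).
  exact: cmp_row_size (cmp_var k).
have hv : cmp k.+2 (fun r => r.1.2) := cmp_weaken (cmp_var k).
apply: cmpM; last exact: (@cmp_row_entry beta q s k.+2 _ _ hv (cmp_var k.+1)).
apply: cmpb_eqn; last exact: cmp_weaken (cmp_weaken hi).
apply: cmpD _ (cmp_var k.+1).
exact: (@cmp_row_total _ _ G s k.+2 _ b0 hv).
Qed.

Lemma row_cellE beta q (G : gadget beta q) s n cl i :
  let M := nth 0 (encode_lists n cl) in let b := blocks beta n * q in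
  let R := rows [seq cand b s c |
    c <- [seq c <- iota 0 (b ^ s * s.+1) | excluded_cand G n s cl c]] in
  nth 0 R i = row_cell G s M i /\ size R = row_total G s M (cand_count beta q s M).
Proof.
move=> M b R; rewrite /R rows_filter; set F := fun c : nat => if _ then _ else _.
have szF c : size (F c) = row_size G s M c.
  by rewrite /F /row_size excluded_cand_memE; case: ifP => //=; rewrite size_mkseq.
have entryF c e : e < row_size G s M c -> nth 0 (F c) e = row_entry beta q s M c e.
  rewrite /F /row_size excluded_cand_memE /row_entry; case: ifP => //= _.
  by case: e => [|e] he /=; [rewrite size_mkseq|rewrite subn1 nth_mkseq].
split.
  rewrite nth_flatten_iota; apply: eq_bigr => c _; rewrite szF; apply: eq_bigr => e _.
  congr (((_ + _) == _) * _); first by apply: eq_bigr => d _; rewrite szF.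
  exact: entryF (ltn_ord e).
rewrite size_flatten /shape -map_comp sumnE big_map.
rewrite [RHS](_ : _ = \sum_(0 <= c < b ^ s * s.+1) row_size G s M c); last by rewrite big_mkord.
by rewrite /index_iota subn0; apply: eq_bigr => c _; apply: szF.
Qed.

Lemma cnf_time_reduction beta q (G : gadget beta q) k : 0 < beta -> exists K, forall T,
  computed_in_time (parity_hitting_set (k.+1 * q)) T ->
  computed_in_time (parity_cnf_sat k) (fun n => n.+2 ^ K + T (blocks beta n * q)).
Proof.
move=> b0; set s := k.+1 * q.
pose count M := \sum_(c < cand_count beta q s M) excluded_cand_mem G s M c.
pose out (g : ctx 1) := if g.2 == 0 then universe beta q g.1
  else if g.2 == 1 then count g.1 else row_cell G s g.1 (g.2 - 2).
(* The output size plus the input size, so that both words fit; surplus cells come out as 0. *)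
pose len (g : ctx 0) := row_total G s g (cand_count beta q s g) + 2 + start g (g 1).
have hlen : cmp 0 len.
  apply: cmpD; last by apply: (@cmp_start 0); exact: (@cmp_mem 0 _ (cmp_cst _ _)).
  apply: cmpD _ (cmp_cst _ _).
  exact: (@cmp_row_total _ _ G s 0 _ b0 (cmp_cand_count 0 beta q s)).
have hout : cmp 1 out.
  apply: cmp_if; first exact: cmpb_eqn (cmp_var _) (cmp_cst _ _).
    exact: (cmp_universe 1).
  apply: cmp_if; first exact: cmpb_eqn (cmp_var _) (cmp_cst _ _).
    apply: (@cmp_sum 1 (fun g => cand_count beta q s g.1) (fun g c => excluded_cand_mem G s g.1 c)).
      exact: (cmp_cand_count 1).
    exact: (@cmpb_excluded_cand _ _ G s 2 _ b0 (cmp_var 1)).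
  exact: (@cmp_row_cell _ _ G s 1 _ b0 (cmpB (cmp_var 0) (cmp_cst _ _))).
apply: (@computed_in_time_reduction _ _ (fun n => blocks beta n * q) (2 * k + 2 + k) _ _ hlen hout).
move=> n w b h; have [b1 b2 b3] := bound_exp n k.
have up m V : V <= n.+2 ^ m -> m <= 2 * k + 2 + k -> V <= n.+2 ^ (2 * k + 2 + k).
  by move=> hV hm; apply: leq_trans hV _; rewrite leq_pexp2l.
split.
  case: h => F [h1 h2 _]; apply: encodes_bounded h1 h2 _ _ _ _.
  - move=> [v sg]; apply: (up 2); last by clear; lia.
    apply: leq_trans b2; rewrite /literal_code /=; have := ltn_ord v; case: sg; clear; lia.
  - by apply: (up 1); [rewrite expn1|]; clear; lia.
  - by apply: up b1 _; clear; lia.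
  - rewrite card_prod card_ord card_bool mulnC; apply: (up (2 * k)) b3 _; by clear; lia.
have [cl [-> hX]] := cnf_to_hitting_set G b0 h; cbv zeta in hX.
set M := nth 0 (encode_lists n cl); set w' := encode_lists _ _ in hX.
have cellE i := row_cellE G s n cl i; have [_ szR] := cellE 0.
have lenE : len M = row_total G s M (cand_count beta q s M) + 2 + size (encode_lists n cl).
  by rewrite size_encode_lists.
exists w'; split=> //.
- by rewrite lenE leq_addl.
- rewrite lenE -szR; apply: leq_trans (leq_addr _ _); by rewrite addn2.
move=> [|[|i]] hi; rewrite /out //=; last by rewrite subSS subSS subn0; have [<- _] := cellE i.
rewrite size_map size_filter -sum1_count big_mkcond /=.
rewrite -[X in iota 0 X]subn0 -/(index_iota _ _) big_mkord; apply: eq_bigr => c _.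
by rewrite excluded_cand_memE; case: excluded_cand.
Qed.

(** * Existence of efficient gadgets *)

(** The [m.+1] binomial coefficients add up to [2 ^ m], so they cannot all be below the average. *)
Lemma large_binomial m N : N * m.+1 <= 2 ^ m -> exists h, N <= 'C(m, h).
Proof.
move=> hN; case: (boolP [exists h : 'I_m.+1, N <= 'C(m, h)]) => [/existsP[h hh]|].
  by exists h.
rewrite negb_exists => /forallP small.
have := expnDn 1 1 m; under eq_bigr => i _ do rewrite !exp1n !muln1.
move=> e; move: hN; rewrite [2 ^ m]e => hN.
have : \sum_(i < m.+1) ('C(m, i)).+1 <= N * m.+1.
  have -> : N * m.+1 = \sum_(i < m.+1) N by rewrite sum_nat_const card_ord mulnC.
  by apply: leq_sum => i _; have := small i; rewrite -ltnNge.
move=> /leq_trans /(_ hN); rewrite (eq_bigr (fun i : 'I_m.+1 => 'C(m, i) + 1)); last first.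
  by move=> i _; rewrite addn1.
by rewrite big_split /= sum_nat_const card_ord muln1 -[X in _ <= X]addn0 leq_add2l.
Qed.

Lemma injection_of_card (T U : finType) (B : {set U}) :
  #|T| <= #|B| -> exists2 f : T -> U, injective f & forall x, f x \in B.
Proof.
move=> hT; have lt (x : T) : enum_rank x < #|B| by apply: leq_trans (ltn_ord _) hT.
exists (fun x => enum_val (Ordinal (lt x))); last by move=> x; apply: enum_valP.
by move=> x y /enum_val_inj [] /val_inj /enum_rank_inj.
Qed.

(* The codes are [h]-subsets of an [m]-set with an additional point, and a set
   is junk when its trace on the [m]-set has more than [h] elements. *)
Lemma gadget_exists beta m : 2 ^ beta * m.+1 <= 2 ^ m -> inhabited (gadget beta m.+1).
Proof.
move=> /large_binomial [h]; rewrite -{1}(card_ord m) -card_draws => hh.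
have cB : #|{ffun 'I_beta -> bool}| <= #|[set A : {set 'I_m} | #|A| == h]|.
  by rewrite card_ffun card_bool card_ord.
have [F F_inj Fh] := injection_of_card cB.
(* As [ord0] lies in every code, a strict superset must gain a point of the [m]-set and becomes
   junk; toggling [ord0] leaves the trace unchanged. *)
pose f a : {set 'I_m.+1} := ord0 |: lift ord0 @: F a.
have f0 a : f a :\ ord0 = lift ord0 @: F a.
  rewrite /f finset.setU1K //; apply/imsetP => -[x _ /eqP].
  by rewrite (negbTE (neq_lift _ _)).
have cf a : #|f a :\ ord0| = h.
  by rewrite f0 card_imset; [apply/eqP; have := Fh a; rewrite inE|exact: lift_inj].
have f1 a : ord0 \in f a by rewrite !inE eqxx.
constructor; apply: (@Gadget _ _ f [pred X | h < #|X :\ ord0|] ord0).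
- move=> a b e; apply: F_inj; apply: (finset.imset_inj (@lift_inj _ ord0)).
  by rewrite -!f0 e.
- move=> X Y XY /= /leq_trans; apply; apply/subset_leq_card/finset.setSD/XY.
- move=> a Y aY /=; have := proper_card aY.
  rewrite (cardsD1 ord0) (cardsD1 ord0 Y) f1 (fintype.subsetP (proper_sub aY) _ (f1 a)).
  by rewrite ltn_add2l cf.
- by move=> a /=; rewrite cf ltnn.
- move=> X /=; congr (_ < #|pred_of_set _|); apply/setP => x.
  by rewrite !inE in_toggle; case: eqP.
Qed.

Lemma efficient_gadget (R : realType) (eps eps' : R) :
  (0 < eps)%R -> (eps < eps')%R -> (eps' < 1)%R ->
  exists beta q, [/\ inhabited (gadget beta q), 0 < beta, beta <= q
                   & (eps * q%:R <= eps' * beta%:R)%R].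
Proof.
move=> e0 ee e1; pose d := (eps' - eps)%R.
have d0 : (0 < d)%R by rewrite subr_gt0.
have [i hi] : exists i : nat, (2 <= d * i%:R)%R.
  exists (Num.truncn (2 / d)).+1; rewrite mulrC -ler_pdivrMr //.
  by apply/ltW/truncnS_gt.
(* With [m.+1 = 2 ^ j] the condition of [gadget_exists] holds with equality, and the rate condition
   becomes [j.+1 * eps' <= d * 2 ^ j]. It follows from [j.+1 <= 2 * i.+1], [2 <= d * 2 ^ i] and
   [i.+1 <= 2 ^ i]. *)
pose j := 2 * i; pose m := (2 ^ j).-1; pose beta := m - j.
have j2 : j < 2 ^ j by apply: ltn_expl.
have mq : m.+1 = 2 ^ j by rewrite prednK // expn_gt0.
have hb : beta + j.+1 = 2 ^ j by rewrite -mq addnS subnK // -ltnS mq.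
have big : (j.+1%:R * eps' <= d * (2 ^ j)%:R :> R)%R.
  have h1 : (j.+1%:R <= 2 * i.+1%:R :> R)%R.
    by rewrite -natrM ler_nat /j; clear; lia.
  have h2 : (i.+1%:R * (2 ^ i)%:R <= (2 ^ j)%:R :> R)%R.
    by rewrite -natrM ler_nat /j mul2n -addnn expnD leq_mul2r ltn_expl ?orbT.
  have h3 : (2 <= d * (2 ^ i)%:R)%R.
    apply: le_trans hi _; rewrite ler_pM2l // ler_nat; exact/ltnW/ltn_expl.
  have h4 : (0 <= i.+1%:R :> R)%R by [].
  have h5 : (0 <= j.+1%:R :> R)%R by [].
  have s1 : (j.+1%:R * eps' <= j.+1%:R :> R)%R by rewrite ler_piMr // ltW.
  have s2 : (2 * i.+1%:R <= d * (2 ^ i)%:R * i.+1%:R :> R)%R by rewrite ler_wpM2r.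
  have s3 : (d * (i.+1%:R * (2 ^ i)%:R) <= d * (2 ^ j)%:R :> R)%R by rewrite ler_pM2l.
  apply: le_trans s1 (le_trans h1 (le_trans s2 _)); apply: le_trans s3.
  by rewrite mulrA [X in (_ <= X)%R]mulrAC.
have key : (eps * (m.+1)%:R <= eps' * beta%:R)%R.
  have : ((2 ^ j)%:R = beta%:R + j.+1%:R :> R)%R by rewrite -hb natrD.
  move: big; rewrite mq /d => big e; rewrite e in big *; clear -big; lra.
exists beta, m.+1; split=> //.
- by apply: gadget_exists; rewrite mq -expnD leq_pexp2l // /beta subnK // -ltnS mq.
- rewrite lt0n; apply/eqP => b0; move: key; rewrite b0 mulr0 leNgt.
  by rewrite mulr_gt0 // ltr0n.
- by rewrite leqW // leq_subr.
Qed.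

(** The size bound grows from [k] to [k.+1 * q], where [q] depends on the exponents; hence hitting
    sets must be assumed easy for all bounds at once. *)
Lemma cnf_from_hitting_set (R : realType) (eps eps' : R) :
  (0 < eps)%R -> (eps < eps')%R -> (eps' < 1)%R ->
  (forall k, computed_in_exp_time (parity_hitting_set k) eps) ->
  forall k, computed_in_exp_time (parity_cnf_sat k) eps'.
Proof.
move=> e0 ee e1 hs k; have [beta [q [[G] b0 bq hq]]] := efficient_gadget e0 ee e1.
have [K red] := cnf_time_reduction G k b0.
apply: computed_in_exp_time_reduction (lt_trans e0 ee) _ _ red (hs _) => [n|n].
  by apply: (leq_trans (ltnW (ltn_ceil n b0))); rewrite leq_mul2l bq orbT.
(* The constant [eps * q] pays for the extra block; the full blocks satisfy [eps * q <= eps' * beta]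
   each. *)
apply: (_ : _ <= eps' * n%:R + eps * q%:R)%R.
rewrite /blocks mulSn natrD mulrDr addrC lerD2r natrM mulrCA.
apply: le_trans (_ : (n %/ beta)%:R * (eps' * beta%:R) <= _)%R; first by rewrite ler_wpM2l.
by rewrite mulrCA -natrM ler_pM2l ?(lt_trans e0) // ler_nat leq_trunc_div.
Qed.

Lemma hitting_set_from_cnf (R : realType) (eps : R) k : (0 < eps)%R ->
  computed_in_exp_time (parity_cnf_sat k) eps ->
  computed_in_exp_time (parity_hitting_set k) eps.
Proof.
move=> e0; have [K red] := hitting_set_time_reduction k.
apply: (@computed_in_exp_time_reduction _ _ _ id K eps eps 0%R) => // n.
by rewrite addr0.
Qed.

Lemma parity_SETH_hitting_set (R : realType) :
  parity_SETH R <-> (forall eps : R, (eps < 1)%R ->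
    exists k : nat, ~ computed_in_exp_time (parity_hitting_set k) eps).
Proof.
(* Exponents may be zero or negative, where polynomial overhead cannot be absorbed. Enlarging the
   exponent is harmless, since refuting a larger one refutes the smaller. *)
have clip (eps : R) : (eps < 1)%R -> exists e : R, [/\ 0 < e, eps <= e & e < 1]%R.
  move=> h; exists (Num.max eps 2^-1)%R; rewrite lt_max le_max gt_max lexx h /=.
  by split=> //; lra.
split=> H eps e1; have [e [h0 he h1]] := clip _ e1.
  apply: contrapT => /forallNP hk.
  (* The midpoint between [e] and 1 leaves room for the rate of the gadget. *)
  have h2 : (e < (1 + e) / 2)%R by lra.
  have h3 : ((1 + e) / 2 < 1)%R by lra.
  have [k] := H _ h3; apply; apply: cnf_from_hitting_set h0 h2 h3 _ _ => k'.
  apply: (computed_in_exp_timeW he); apply: contrapT; exact: hk.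
have [k nk] := H _ h1; exists k; apply: contra_not nk => hk.
exact/(hitting_set_from_cnf h0)/(computed_in_exp_timeW he).
Qed.

Theorem theorem3 (R : realType) :
  [/\ parity_SETH R <->
        (forall eps : R, (eps < 1)%R ->
           exists k : nat, ~ computed_in_exp_time (parity_cnf_sat k) eps),
      parity_SETH R <->
        (forall eps : R, (eps < 1)%R ->
           exists k : nat, ~ computed_in_exp_time (parity_hitting_set k) eps) &
      parity_SETH R <->
        (forall eps : R, (eps < 1)%R ->
           exists k : nat, ~ computed_in_exp_time (parity_set_cover k) eps)].
Proof.
have coverE : parity_set_cover = parity_hitting_set.
  by apply/funext => k; exact: parity_set_coverE.
by split; rewrite ?coverE //; exact: parity_SETH_hitting_set.
Qed.
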